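(* Let $c>0$ be a real number with $c\notin\mathbb{N}$, let $k\in\mathbb{N}$, and let $S_1,\dots,S_k\subseteq\mathbb{N}$ satisfy $\overline{d}(S_i)>0$ for each $i=1,\dots,k$. Put $D_c=\bigcap_{i=1}^k\Delta_{2,c}(S_i)$. Then there is a set $S\subseteq\mathbb{N}$ with $d(S)\ge\prod_{i=1}^k\overline{d}(S_i)$ and $\Delta_{1,c}(S)\subseteq D_c$; furthermore, $\overline{d}(\Delta_{1,c}(S))\ge\prod_{i=1}^k\overline{d}(S_i)$. In addition, the set $D_c$ is thick, meaning that for all $n\in\mathbb{N}$ there is $a\in\mathbb{N}$ such that $\{a,a+1,\dots,a+n\}\subseteq D_c$.
   Context: $\mathbb{N}=\{1,2,3,\dots\}$. For $S\subseteq\mathbb{N}$, $\overline{d}(S)=\limsup_{N\to\infty}|S\cap\{1,\dots,N\}|/N$ and $\underline{d}(S)=\liminf_{N\to\infty}|S\cap\{1,\dots,N\}|/N$; if these are equal, the common value is denoted $d(S)$ (natural density). An assertion about $d(S)$ includes the assertion that it exists. For $S\subseteq\mathbb{N}$ and $m\in\mathbb{N}$, $S-m=\{j\in\mathbb{N}: j+m\in S\}$. $[\cdot]$ denotes the integral part. For $c>0$ and $S\subseteq\mathbb{N}$, $\Delta_{1,c}(S)=\{n\in\mathbb{N}: S\cap(S-[n^c])\ne\emptyset\}$ and $\Delta_{2,c}(S)=\{n\in\mathbb{N}:\overline{d}(S\cap(S-[n^c]))>0\}$. *)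

(* Defs.v *)
From HB Require Import structures.
From mathcomp Require Import all_boot all_order all_algebra.
From mathcomp Require Import all_classical all_reals all_analysis.

Set Implicit Arguments.
Unset Strict Implicit.
Unset Printing Implicit Defensive.

Import Order.TTheory GRing.Theory Num.Theory.

Local Open Scope classical_set_scope.
Local Open Scope ring_scope.

(* The natural numbers start at 1 here: a subset of N is encoded as a
   S : set nat with S `<=` posnats. *)
Definition posnats : set nat := [set n | (0 < n)%N].

(* The term N = 0 is 0 / 0 = 0; it does not affect the limits below. *)
Definition freq (R : realType) (S : set nat) : R^nat :=
  fun N => (count (fun j => j \in S) (iota 1 N))%:R / N%:R.

Definition upper_density (R : realType) (S : set nat) : R :=
  limn_sup (freq R S).

Definition lower_density (R : realType) (S : set nat) : R :=
  limn_inf (freq R S).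

(* d(S) exists and is equal to x. *)
Definition has_density (R : realType) (S : set nat) (x : R) : Prop :=
  lower_density R S = x /\ upper_density R S = x.

Definition shift_down (S : set nat) (m : nat) : set nat :=
  [set j | posnats j /\ S (j + m)%N].

(* n ^ c is nonnegative, so Num.truncn is the integral part. *)
Definition ipow (R : realType) (c : R) (n : nat) : nat :=
  Num.truncn (n%:R `^ c).

Definition Delta1 (R : realType) (c : R) (S : set nat) : set nat :=
  [set n | posnats n /\ S `&` shift_down S (ipow c n) !=set0].

Definition Delta2 (R : realType) (c : R) (S : set nat) : set nat :=
  [set n | posnats n /\
           0 < upper_density R (S `&` shift_down S (ipow c n))].

Definition thick (D : set nat) : Prop :=
  forall n, posnats n ->
    exists2 a, posnats a & forall i, (i <= n)%N -> D (a + i)%N.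

(* Main.v *)
Require Import Defs.
From HB Require Import structures.
From mathcomp Require Import all_boot all_order all_algebra.
From mathcomp Require Import all_classical all_reals all_analysis.
From mathcomp Require Import ring lra zify.

(** Call a set admissible when all differences of its elements lie in the set A
of the m such that every S_i meets S_i - m in a set of positive upper density.
If S is admissible, then Delta1 c S is contained in D. So the theorem follows
from the existence of an admissible S of density at least p, the product of the
upper densities of the S_i, and from properties of Delta1 c S for any set S
with at least p n elements up to n, for all n.

Admissible sets. For a finite set E, averaging over translations shows that
some translate of S_i contains a proportion at least the upper density of S_i
of E, without any of the differences that occur with density zero in S_i
([dense_copy]). Doing this for each i, one finds in every window of length L an
admissible set with at least p L elements. Let q >= p be the largest
proportion attainable in all windows. An ultrafilter limit of well chosen
translates is an admissible set with at least q n elements up to n, for all n,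
and by maximality of q it cannot have larger upper density; so its density
exists ([density_attained]).

Equidistribution. Let d be the integral part of c and a_i(n), for i <= d, the
i-th difference of n^c. A real combination of the a_i grows like n^(c - i),
where i is the index of its first nonzero coefficient. The exponent is not an
integer, so van der Corput differencing reduces it to an exponent in (0, 1), for
which the cosine sums telescope ([weyl]). Products of Fejer kernels then select
the n for which the fractional parts of the a_i(n) are close to given targets,
and for these n a character of the integral parts of the a_i(n) is nearly a
character of the a_i(n) themselves.

Recurrence. The number of pairs of a finite set at distance m is a nonnegative
combination of the cosines of 2 pi xi m / Q, in which the frequency 0 has
relative weight at least nearly p ([corr_spectrum]). So to find many m, in a given
family, that are differences of S, it is enough that the averages of the other
cosines over the family are not much below 0. Averages up to a single N do not
have this property, because of frequencies close to but different from 0.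
Averages over several scales N do, as each frequency is harmful at few
scales ([multiscale], [weight_core]). For the family of the [n^c], with all
targets for the fractional part of n^c taken together, this gives the upper
density of Delta1 c S ([Delta1_density]). For the vectors ([(n + j)^c]) with
j <= L, whose entries are integral combinations of the integral parts of the
a_i(n) when the targets are suitable, it gives an n with all the [(n + j)^c]
among the differences of S ([Delta1_thick]). *)

Set Implicit Arguments.
Unset Strict Implicit.
Unset Printing Implicit Defensive.

Import Order.TTheory GRing.Theory Num.Theory.
Import numFieldNormedType.Exports.

Local Open Scope classical_set_scope.
Local Open Scope ring_scope.

(** * Upper density *)

Section Density.
Variable R : realType.
Implicit Types (S : set nat).

Definition cnt S (x n : nat) : nat := count (fun j => j \in S) (iota x.+1 n).

Lemma freqE S N : freq R S N = (cnt S 0 N)%:R / N%:R.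
Proof. by []. Qed.

Lemma cnt_le S x n : (cnt S x n <= n)%N.
Proof. by rewrite /cnt (leq_trans (count_size _ _))// size_iota. Qed.

Lemma freq_ge0 S N : 0 <= freq R S N.
Proof. by rewrite divr_ge0. Qed.

Lemma freq_le1 S N : freq R S N <= 1.
Proof.
rewrite freqE; case: N => [|N]; first by rewrite invr0 mulr0.
by rewrite ler_pdivrMr// mul1r ler_nat cnt_le.
Qed.

Lemma freq_bounded S : bounded_fun (freq R S).
Proof.
exists 1; split => // y y1 n _ /=.
by rewrite ger0_norm ?freq_ge0// (le_trans (freq_le1 S n)) ?ltW.
Qed.

Lemma sdrop_freq S N :
  has_sup (sdrop (freq R S) N).
Proof.
split; first by exists (freq R S N), N => //=.
by exists 1 => _ [n _ <-]; exact: freq_le1.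
Qed.

Lemma has_inf_sups S : has_inf (range (sups (freq R S))).
Proof.
split; first by exists (sups (freq R S) 0%N), 0%N.
exists 0 => _ [n _ <-] /=.
apply: (le_trans (freq_ge0 S n)); apply: ub_le_sup; last by exists n => /=.
by case: (sdrop_freq S n).
Qed.

Lemma upper_densityE S : upper_density R S = inf (range (sups (freq R S))).
Proof. exact: limn_supE (freq_bounded S). Qed.

(** The next three lemmas replace the limit superior by its description
through arbitrarily large N, the only form used below. *)
Lemma upper_density_ge S x :
  (forall N0, exists2 N, (N0 <= N)%N & x <= freq R S N) ->
  x <= upper_density R S.
Proof.
move=> h; rewrite upper_densityE; apply: lb_le_inf.
  by case: (has_inf_sups S).
move=> _ [n _ <-] /=; have [N nN xN] := h n.
apply: (le_trans xN); apply: ub_le_sup; last by exists N.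
by case: (sdrop_freq S n).
Qed.

Lemma upper_density_gtP S y : y < upper_density R S ->
  forall N0, exists2 N, (N0 <= N)%N & y < freq R S N.
Proof.
move=> yS N0.
have : y < sups (freq R S) N0.
  apply: (lt_le_trans yS); rewrite upper_densityE; apply: ge_inf.
    by case: (has_inf_sups S).
  by exists N0.
move=> /(sup_gt _)[|_ [N /= NN0 <-] yN].
  by case: (sdrop_freq S N0).
by exists N.
Qed.

Lemma upper_density_ltP S y : upper_density R S < y ->
  exists N0, forall N, (N0 <= N)%N -> freq R S N < y.
Proof.
rewrite upper_densityE => /(inf_lt (has_inf_sups S).1)[_ [N0 _ <-] /= h].
exists N0 => N NN0; apply: le_lt_trans h; apply: ub_le_sup; last by exists N.
by case: (sdrop_freq S N0).
Qed.

Lemma has_density_cvg S (x : R) : freq R S @ \oo --> x -> has_density S x.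
Proof. by move=> /cvg_limn_inf_sup[]. Qed.

End Density.

(** * Dense copies of finite sets *)

Lemma common_threshold (T : eqType) (s : seq T) (P : T -> nat -> Prop) :
  (forall p, p \in s -> exists N0, forall N, (N0 <= N)%N -> P p N) ->
  exists N0, forall p N, p \in s -> (N0 <= N)%N -> P p N.
Proof.
elim: s => [|p s IH] h; first by exists 0%N.
have [|N0 hN0] := IH; first by move=> q qs; apply: h; rewrite inE qs orbT.
have [|N1 hN1] := h p; first by rewrite inE eqxx.
exists (maxn N0 N1) => q N; rewrite inE geq_max => /orP[/eqP->|qs] /andP[? ?].
  exact: hN1.
exact: hN0.
Qed.

Section Copy.
Variable R : realType.
Implicit Types (S : set nat).

(** Turns a strict inequality between integers and a real bound into a uniform
gap, so that a limit of averages cannot close it. *)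
Lemma natr_gap (y : R) :
  exists2 eta : R, 0 < eta & forall k : nat, k%:R < y -> k%:R <= y - eta.
Proof.
have [y0|y0] := ltP y 0.
  by exists 1 => // k /(le_lt_trans (ler0n R k)) /ltW; rewrite leNgt y0.
have /andP[ty yt] := truncn_itv y0; set m := Num.truncn y in ty yt.
have [my|my] := ltP m%:R y.
  exists (y - m%:R); first by rewrite subr_gt0.
  move=> k ky; rewrite opprB addrC subrK ler_nat -ltnS -(ltr_nat R).
  exact: lt_trans yt.
exists 1 => // k ky; rewrite lerBrDr natr1 (le_trans _ ty)// ler_nat.
by rewrite -(ltr_nat R) (lt_le_trans ky).
Qed.

Lemma count_iota_shift (P : pred nat) u N :
  (count P (iota u N) <= count P (iota 1 N) + u.+1)%N /\
  (count P (iota 1 N) <= count P (iota u N) + u.+1)%N.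
Proof.
have h1 : (count P (iota 0 u) + (count P (iota u N) + count P (iota (u + N) 1)) =
     count P (iota 0 1) + (count P (iota 1 N) + count P (iota N.+1 u)))%N.
  have e1 : iota 0 (1 + (N + u)) = iota 0 1 ++ (iota 1 N ++ iota N.+1 u).
    by rewrite !iotaD add0n add1n.
  have e2 : iota 0 (u + (N + 1)) = iota 0 u ++ (iota u N ++ iota (u + N) 1).
    by rewrite !iotaD.
  by rewrite -!count_cat -e1 -e2; congr (count _ (iota _ _)); lia.
have := count_size P (iota 0 u); have := count_size P (iota (u + N) 1).
have := count_size P (iota 0 1); have := count_size P (iota N.+1 u).
rewrite !size_iota; lia.
Qed.

Lemma sum_shift_count S u N :
  \sum_(x < N) ((x + u)%N \in S)%:R = (count (fun j => j \in S) (iota u N))%:R :> R.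
Proof.
rewrite -(big_mkord predT (fun x => ((x + u)%N \in S)%:R)).
rewrite -natr_sum -sum1_count [in RHS]big_mkcond/= -[in iota u N](addn0 u) iotaDl.
rewrite big_map /index_iota subn0; congr (_%:R); apply: eq_bigr => i _.
by rewrite addnC; case: (_ \in _).
Qed.

(** Average over the translates by x < N. The mean number of u in E with x + u
in S is the density of S in {1, ..., N} times the size of E, up to a bounded
error, while the x for which two of these points have a difference m with
S and S - m meeting in a null set form a set of density zero. If every other
x did worse than the upper density of S, it would do so by a fixed amount
([natr_gap]), which the average over a suitable N excludes. *)
Lemma dense_copy S (E : seq nat) : S `<=` posnats -> 0 < upper_density R S ->
  exists x, upper_density R S * (size E)%:R
              <= (count (fun u => (x + u)%N \in S) E)%:R /\
    forall u v, u \in E -> v \in E -> (u <= v)%N ->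
      (x + u)%N \in S -> (x + v)%N \in S ->
      0 < upper_density R (S `&` shift_down S (v - u)).
Proof.
move=> Spos dS; set sig := upper_density R S.
pose T (p : nat * nat) := S `&` shift_down S (p.2 - p.1).
(* the pairs whose difference occurs in S with density zero *)
pose prs := [seq p <- [seq (u, v) | u <- E, v <- E] |
               (p.1 <= p.2)%N && (upper_density R (T p) <= 0)].
have Tprs x u v : u \in E -> v \in E -> (u <= v)%N ->
    (x + u)%N \in S -> (x + v)%N \in S ->
    ~ 0 < upper_density R (S `&` shift_down S (v - u)) ->
    (u, v) \in prs /\ (x + u)%N \in T (u, v).
  move=> uE vE uv /set_mem xu /set_mem xv /negP; rewrite -leNgt => h; split.
    rewrite mem_filter /= uv h /=; apply/allpairsP; by exists (u, v).
  apply/mem_set; split => //; split; first exact: Spos.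
  by rewrite -addnA (subnKC uv).
case: (eqVneq E [::]) => [E0|E0].
  by exists 0%N; rewrite E0 mulr0.
have sE : 0 < (size E)%:R :> R by rewrite ltr0n lt0n size_eq0.
apply: contrapT => hno.
have [eta eta0 hgap] := natr_gap (sig * (size E)%:R).
have y0 : 0 <= sig * (size E)%:R - eta.
  by apply: (hgap 0%N); rewrite mulr_gt0.
have hx x : (count (fun u => (x + u)%N \in S) E)%:R <= sig * (size E)%:R - eta +
    (size E)%:R * \sum_(p <- prs) ((x + p.1)%N \in T p)%:R.
  have [[p pp xp]|nobad] := pselect (exists2 p, p \in prs & (x + p.1)%N \in T p).
    rewrite -[leLHS]add0r lerD// (@le_trans _ _ ((size E)%:R * 1))//.
      by rewrite mulr1 ler_nat count_size.
    rewrite ler_wpM2l// (big_rem p)//= xp lerDl sumr_ge0//.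
  have : (count (fun u => (x + u)%N \in S) E)%:R < sig * (size E)%:R.
    rewrite ltNge; apply/negP => h; apply: hno; exists x; split => // u v uE vE uv xu xv.
    apply: contrapT => hn; apply: nobad; exists (u, v); by have [] := Tprs x u v.
  move/hgap => h; apply: (le_trans h); rewrite lerDl mulr_ge0// sumr_ge0//.
(* chosen so that the translates meeting a pair of prs cost at most eta / 4 on
   average *)
pose e : R := eta / (4 * (size E)%:R * ((size prs)%:R + 1)).
have e0 : 0 < e by rewrite divr_gt0// !mulr_gt0// ltr_wpDl.
have [p|N0 hN0] := @common_threshold _ prs (fun p N => freq R (T p) N < e).
  rewrite mem_filter => /andP[/andP[_ Tp] _].
  by apply: upper_density_ltP; rewrite (le_lt_trans Tp).
(* total of the boundary errors in the counts over shifted windows *)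
pose K : nat := (sumn [seq u.+1 | u <- E] + sumn [seq (p.1).+1 | p <- prs] * size E)%N.
have [N1 hN1] : exists N1 : nat, K%:R < N1%:R * (eta / 4).
  exists (Num.truncn (K%:R / (eta / 4))).+1.
  by rewrite -ltr_pdivrMr ?divr_gt0// truncnS_gt.
have [N NN hN] : exists2 N, (maxn 1 (maxn N0 N1) <= N)%N & sig - eta / (4 * (size E)%:R) < freq R S N.
  by apply: upper_density_gtP; rewrite ltrBlDr ltrDl divr_gt0// mulr_gt0.
move: NN; rewrite !geq_max => /and3P[N_gt0 NN0 NN1].
have Npos : 0 < N%:R :> R by rewrite ltr0n.
have low : (size E)%:R * (cnt S 0 N)%:R - (sumn [seq u.+1 | u <- E])%:R <=
    \sum_(x < N) (count (fun u => (x + u)%N \in S) E)%:R :> R.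
  under eq_bigr do rewrite -sum1_count natr_sum big_mkcond /=.
  rewrite exchange_big /= sumnE big_map natr_sum.
  have -> : (size E)%:R * (cnt S 0 N)%:R = \sum_(u <- E) (cnt S 0 N)%:R :> R.
    by rewrite big_const_seq count_predT iter_addr_0 mulr_natl.
  rewrite -sumrB; apply: ler_sum => u _.
  have [_ h] := count_iota_shift (fun j => j \in S) u N.
  rewrite lerBlDr.
  have -> : \sum_(i < N) (if (i + u)%N \in S then 1%:R else 0) =
      (count (fun j => j \in S) (iota u N))%:R :> R.
    by rewrite -sum_shift_count; apply: eq_bigr => i _; case: (_ \in S).
  by rewrite -natrD ler_nat.
have up : \sum_(x < N) (count (fun u => (x + u)%N \in S) E)%:R <=
   N%:R * (sig * (size E)%:R - eta) +
   (size E)%:R * ((size prs)%:R * (e * N%:R) + (sumn [seq (p.1).+1 | p <- prs])%:R).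
  apply: (le_trans (ler_sum _ (fun (x : 'I_N) _ => hx x))).
  rewrite big_split /= sumr_const card_ord -[X in X + _ <= _]mulr_natl lerD2l.
  rewrite -mulr_sumr ler_wpM2l// exchange_big /= sumnE big_map natr_sum.
  have -> : (size prs)%:R * (e * N%:R) = \sum_(u <- prs) (e * N%:R) :> R.
    by rewrite big_const_seq count_predT iter_addr_0 mulr_natl.
  rewrite -big_split /= big_seq_cond [leRHS]big_seq_cond.
  apply: ler_sum => p; rewrite andbT => pp.
  rewrite sum_shift_count.
  have [h _] := count_iota_shift (fun j => j \in T p) p.1 N.
  apply: (@le_trans _ _ ((cnt (T p) 0 N)%:R + (p.1).+1%:R)).
    by rewrite -natrD ler_nat.
  rewrite lerD2r -ler_pdivrMr//.
  by apply: ltW; apply: (hN0 p N).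
have KN : K%:R < N%:R * (eta / 4).
  by apply: (lt_le_trans hN1); rewrite ler_wpM2r ?divr_ge0 ?ler_nat// ltW.
move: hN; rewrite freqE ltr_pdivlMr// => hN.
have eE : (size E)%:R * ((size prs)%:R * (e * N%:R)) <= N%:R * (eta / 4).
  have -> : (size E)%:R * ((size prs)%:R * (e * N%:R)) =
    N%:R * (eta / 4) * ((size prs)%:R / ((size prs)%:R + 1)).
    rewrite /e; field; rewrite (gt_eqF sE) /= gt_eqF //; exact: ltr_wpDl.
  rewrite ger_pMr; last by rewrite mulr_gt0// divr_gt0.
  by rewrite ler_pdivrMr ?ltr_wpDl// mul1r lerDl.
have hN' : sig * (size E)%:R * N%:R - eta / 4 * N%:R < (size E)%:R * (cnt S 0 N)%:R.
  have -> : sig * (size E)%:R * N%:R - eta / 4 * N%:R =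
      (size E)%:R * ((sig - eta / (4 * (size E)%:R)) * N%:R).
    by field; rewrite gt_eqF.
  by rewrite ltr_pM2l.
move: KN; rewrite /K natrD natrM => KN.
have := le_trans low up.
nra.
Qed.

End Copy.

(** * Admissible sets of maximal density *)

Definition admissible (D X : set nat) :=
  forall u v, X u -> X v -> (u <= v)%N -> D (v - u)%N.

(** Each step of the induction applies [dense_copy] to the set left by the
previous one; subsets inherit the conditions on differences already obtained.
*)
Lemma dense_common_copy (R : realType) (I : eqType) (S_ : I -> set nat)
    (s : seq I) (E : seq nat) :
  (forall i, S_ i `<=` posnats) -> (forall i, 0 < upper_density R (S_ i)) ->
  exists E', [/\ subseq E' E,
    (\prod_(i <- s) upper_density R (S_ i)) * (size E)%:R <= (size E')%:R &
    forall i, i \in s ->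
      admissible [set m | 0 < upper_density R (S_ i `&` shift_down (S_ i) m)]
        [set` E']].
Proof.
move=> Spos Sd; elim: s => [|i s [E' [sE' hE' aE']]].
  by exists E; split => //; rewrite big_nil mul1r.
have [x [hx ax]] := dense_copy E' (Spos i) (Sd i).
exists [seq u <- E' | (x + u)%N \in S_ i]; split.
- exact: subseq_trans (filter_subseq _ _) sE'.
- rewrite big_cons -mulrA size_filter (le_trans _ hx)//.
  by rewrite ler_wpM2l// ltW.
- move=> j; rewrite inE => /orP[/eqP ->|js] u v /=;
    rewrite !mem_filter => /andP[xu uE] /andP[xv vE] uv.
    exact: ax.
  exact: aE'.
Qed.

Section Limit.
Variable R : realType.

Lemma cntD (S : set nat) x m n : cnt S x (m + n) = (cnt S x m + cnt S (x + m) n)%N.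
Proof. by rewrite /cnt iotaD count_cat addSn. Qed.

(** Cover the interval by consecutive sparse pieces of length at most K; only
the last piece, cut off by the end of the interval, is counted trivially. *)
Lemma cnt_le_greedy (S : set nat) (q : R) K : 0 <= q ->
  (forall x, exists n, [/\ (0 < n)%N, (n <= K)%N & (cnt S x n)%:R < q * n%:R]) ->
  forall M x, (cnt S x M)%:R <= q * M%:R + K%:R.
Proof.
move=> q0 h M; have [m] := ubnP M; elim: m M => // m IH M Mm x.
have [MK|KM] := leqP M K.
  rewrite (@le_trans _ _ K%:R)// ?lerDr ?mulr_ge0// ler_nat.
  exact: leq_trans (cnt_le _ _ _) MK.
have [n [n0 nK xn]] := h x.
have Mn : M = (n + (M - n))%N by lia.
rewrite Mn cntD !natrD mulrDr -addrA lerD ?(ltW xn)//.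
by apply: IH; lia.
Qed.

Lemma cnt_le_windows (S : set nat) (q : R) l : (0 < l)%N -> 0 <= q ->
  (forall x, (cnt S x l)%:R <= q * l%:R) ->
  forall M x, (cnt S x M)%:R <= q * M%:R + l%:R.
Proof.
move=> l0 q0 h M; have [m] := ubnP M; elim: m M => // m IH M Mm x.
have [Ml|lM] := leqP M l.
  rewrite (@le_trans _ _ l%:R)// ?lerDr ?mulr_ge0// ler_nat.
  exact: leq_trans (cnt_le _ _ _) Ml.
have Mn : M = (l + (M - l))%N by lia.
rewrite Mn cntD !natrD mulrDr -addrA lerD//.
by apply: IH; lia.
Qed.

Lemma eq_cnt (A B : set nat) x n :
  (forall j, (x < j)%N -> (j <= x + n)%N -> A j <-> B j) -> cnt A x n = cnt B x n.
Proof.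
move=> h; apply: eq_in_count => j; rewrite mem_iota => /andP[xj jn].
apply/idP/idP => /set_mem hj; apply/mem_set; apply/h => //; lia.
Qed.

Lemma cnt_shift (A : set nat) x n :
  cnt [set j | A (x + j)%N] 0 n = cnt A x n.
Proof.
rewrite /cnt -[x.+1]addn1 [in RHS]iotaDl count_map; apply: eq_count => j /=.
by apply/idP/idP => /set_mem hj; apply/mem_set.
Qed.

Variable D : set nat.

(** The supremum of the q with this property is the largest density that an
admissible set can have. *)
Definition window_density (q : R) := forall L, exists2 E : seq nat,
  subseq E (iota 1 L) & admissible D [set` E] /\ q * L%:R <= (size E)%:R.

Lemma cnt_subseq E L : subseq E (iota 1 L) -> cnt [set` E] 0 L = size E.
Proof.
move=> sE; have eE : E = [seq j <- iota 1 L | j \in E].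
  exact/subseq_uniqP/sE/iota_uniq.
rewrite /cnt [in RHS]eE size_filter; apply: eq_count => j.
by apply/idP/idP => [/set_mem|jE] //; apply/mem_set.
Qed.

(** A set of proportion q' in a very long window has a point after which all of
its first K segments have proportion at least q: otherwise [cnt_le_greedy]
would bound its size in the whole window. Translate that point to 0. *)
Lemma good_prefix (q q' : R) K : q < q' -> window_density q' ->
  exists2 X : set nat, admissible D X &
    forall n, (n <= K)%N -> q * n%:R <= (cnt X 0 n)%:R.
Proof.
move=> qq' wq'; have [q0|q0] := ltP q 0.
  exists set0; first by move=> u v [].
  by move=> n _; rewrite (@le_trans _ _ 0)// mulr_le0_ge0// ltW.
pose L := (Num.truncn (K%:R / (q' - q))).+1.
have [E sE [aE hE]] := wq' L.
have [x hx] : exists x, forall n, (0 < n)%N -> (n <= K)%N ->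
    q * n%:R <= (cnt [set` E] x n)%:R.
  apply: contrapT => hno.
  have : forall x, exists n,
      [/\ (0 < n)%N, (n <= K)%N & (cnt [set` E] x n)%:R < q * n%:R].
    move=> x; apply: contrapT => hn; apply: hno; exists x => n n0 nK.
    by rewrite leNgt; apply/negP => h; apply: hn; exists n.
  move=> /(cnt_le_greedy q0)/(_ L 0%N); rewrite cnt_subseq//.
  move=> /(le_trans hE); apply/negP; rewrite -ltNge.
  have : K%:R / (q' - q) < L%:R by exact: truncnS_gt.
  rewrite ltr_pdivrMr ?subr_gt0//; nra.
exists [set j | [set` E] (x + j)%N].
  move=> u v xu xv uv.
  by have := aE _ _ xu xv; rewrite leq_add2l subnDl; apply.
move=> [|n] nK; first by rewrite mulr0.
by rewrite cnt_shift hx.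
Qed.

(** S is the limit of the sets X K along a nonprincipal ultrafilter: on any
finite interval S agrees with X K for K in a set of the ultrafilter, hence for
arbitrarily large K, so finite conditions pass to the limit. *)
Lemma limit_set (q : R) (X : nat -> set nat) :
  (forall K, admissible D (X K)) ->
  (forall K n, (n <= K)%N -> (q - K.+1%:R^-1) * n%:R <= (cnt (X K) 0 n)%:R) ->
  exists S, [/\ S `<=` posnats, admissible D S &
    forall n, q * n%:R <= (cnt S 0 n)%:R].
Proof.
move=> aX hX.
have [U [UU sU]] := ultraFilterLemma (@eventually_filter).
have UP : ProperFilter U by exact: ultra_proper.
exists [set j | (0 < j)%N /\ U [set K | X K j]]; split.
- by move=> j [].
- move=> u v [_ Uu] [_ Uv] uv.
  have [K [Ku Kv]] := filter_ex (filterI Uu Uv).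
  exact: (aX K).
set S := [set j | _].
(* S and X K agree on {1, ..., n} for almost all K *)
have agree n : U [set K | forall j, (0 < j)%N -> (j <= n)%N -> X K j <-> S j].
  elim: n => [|n IH].
    by apply: filterE => K -[].
  have h : U [set K | X K n.+1 <-> S n.+1].
    have [Un|nUn] := pselect (U [set K | X K n.+1]).
      by apply: (filterS _ Un) => K /= XK; split=> [_|_ //]; split.
    have [//|UC] := in_ultra_setVsetC [set K | X K n.+1] UU.
    by apply: filterS UC => K /= XK; split => [/XK|[_ /nUn]].
  apply: filterS (filterI IH h) => K [/= hK hn] j j0.
  by rewrite leq_eqVlt => /orP[/eqP->//|]; rewrite ltnS; exact: hK.
move=> n; apply/ler_addgt0Pr => e e0.
pose m := maxn n (Num.truncn (n%:R / e)).
have Um : U [set K | (m <= K)%N] by apply: sU; exists m.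
have [K [/= hK mK]] := filter_ex (filterI (agree n) Um).
have nK : (n <= K)%N by apply: leq_trans mK; exact: leq_maxl.
have := hX K n nK; rewrite (@eq_cnt _ S) => [|j j0 jn]; last exact: hK.
rewrite mulrBl lerBlDr => /le_trans; apply; rewrite lerD2l.
rewrite mulrC ler_pdivrMr// mulrC -ler_pdivrMr//; apply: ltW.
rewrite (lt_le_trans (truncnS_gt _))// ler_nat ltnS (leq_trans _ mK)//.
exact: leq_maxr.
Qed.

(** With q the supremum of the window densities, the limit set has at least q n
elements up to n for every n. Conversely q + e / 2 is not a window density, so
some length l admits no admissible set of that proportion; cutting an interval
into pieces of length l bounds the upper density by q + e / 2. *)
Lemma density_attained (p : R) : 0 <= p -> window_density p ->
  exists S x, [/\ S `<=` posnats, admissible D S, has_density S x, p <= x &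
    forall n, x * n%:R <= (cnt S 0 n)%:R].
Proof.
move=> p0 wp; pose q := sup window_density.
have hs : has_sup window_density.
  split; first by exists p.
  exists 1 => y /(_ 1%N)[E sE [_]]; rewrite mulr1 => /le_trans; apply.
  by rewrite (ler_nat _ _ 1) -(size_iota 1 1) size_subseq.
have pq : p <= q by apply: ub_le_sup => //; case: hs.
have q0 := le_trans p0 pq.
have hX K : exists X, admissible D X /\
    forall n, (n <= K)%N -> (q - K.+1%:R^-1) * n%:R <= (cnt X 0 n)%:R.
  have [|q' wq' qq'] := @sup_adherent _ window_density K.+1%:R^-1 _ hs.
    by rewrite invr_gt0.
  by have [X aX hX] := good_prefix K qq' wq'; exists X.
have /choice[X XP] := hX.
have [||S [Spos aS hS]] := @limit_set q X.
- by move=> K; case: (XP K).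
- by move=> K; case: (XP K).
exists S, q; split => //.
apply: has_density_cvg; apply/cvgrPdist_le => e e0.
have e2 : 0 < e / 2 by rewrite divr_gt0.
(* a length for which q + e / 2 is not attained *)
have [l hl] : exists l, forall E, subseq E (iota 1 l) -> admissible D [set` E] ->
    (size E)%:R < (q + e / 2) * l%:R.
  apply: contrapT => hno.
  have : window_density (q + e / 2).
    move=> L; apply: contrapT => hn; apply: hno; exists L => E sE aE.
    rewrite ltNge; apply/negP => h; apply: hn; by exists E.
  move=> /(ub_le_sup hs.2); apply/negP; rewrite -ltNge ltrDl//.
have l0 : (0 < l)%N.
  rewrite lt0n; apply/eqP => l0.
  suff aN : admissible D [set` [::]].
    by have := hl [::] (sub0seq _) aN; rewrite l0 mulr0 ltxx.
  by move=> u v.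
have wS x : (cnt S x l)%:R <= (q + e / 2) * l%:R.
  rewrite -cnt_shift.
  pose E := [seq j <- iota 1 l | (x + j)%N \in S].
  have -> : cnt [set j | S (x + j)%N] 0 l = size E.
    rewrite size_filter; apply: eq_count => j.
    by apply/idP/idP => /set_mem hj; apply/mem_set.
  apply/ltW/hl; first exact: filter_subseq.
  move=> u v /=; rewrite !mem_filter => /andP[/set_mem xu _] /andP[/set_mem xv _] uv.
  by have := aS _ _ xu xv; rewrite leq_add2l subnDl; apply.
exists (Num.truncn (l%:R / (e / 2))).+1 => // N /= NN.
have N0 : 0 < N%:R :> R by rewrite ltr0n (leq_trans _ NN).
rewrite freqE distrC ler_norml; apply/andP; split.
  rewrite (@le_trans _ _ 0) ?oppr_le0 ?(ltW e0)// subr_ge0.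
  by rewrite ler_pdivlMr.
rewrite lerBlDl ler_pdivrMr//.
have := cnt_le_windows l0 (addr_ge0 q0 (ltW e2)) wS N 0%N.
move=> /le_trans; apply.
have -> : q + e = q + e / 2 + e / 2 by field.
rewrite [in leRHS]mulrDl lerD2l mulrC -ler_pdivrMr// ltW//.
by rewrite (lt_le_trans (truncnS_gt _))// ler_nat.
Qed.

End Limit.

(** * Cosine sums of functions growing like a power *)

Section Weyl.
Variable R : realType.

Lemma sin_MVT (x y : R) : exists2 z, `|z - x| <= `|y - x| & sin y - sin x = cos z * (y - x).
Proof.
have cs a b : {within `[a, b], continuous (@sin R)}.
  by apply: continuous_subspaceT; exact: continuous_sin.
wlog xy : x y / x < y.
  move=> h; have [xy|yx|->] := ltgtP x y; first exact: h.
    have [z hz e] := MVT yx (fun z _ => is_derive_sin z) (cs _ _).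
    exists z.
      move: hz; rewrite in_itv /= => /andP[h1 h2].
      rewrite !ltr0_norm ?subr_lt0// ; lra.
    by rewrite -opprB e; ring.
  by exists y; rewrite ?subrr ?normr0 ?mulr0.
have [z hz e] := MVT xy (fun z _ => is_derive_sin z) (cs _ _).
exists z => //.
move: hz; rewrite in_itv /= => /andP[h1 h2].
rewrite !gtr0_norm ?subr_gt0// ; lra.
Qed.

Lemma cos_lip (x y : R) : `|cos y - cos x| <= `|y - x|.
Proof.
have [z _] := sin_MVT (x + pi / 2) (y + pi / 2).
rewrite !sinDpihalf => ->.
have -> : y + pi / 2 - (x + pi / 2) = y - x by ring.
by rewrite normrM ler_piMl// cos_max.
Qed.

Lemma sin_taylor (x q : R) : `|sin (x + q) - sin x - q * cos x| <= q ^+ 2.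
Proof.
have [z hz ->] := sin_MVT x (x + q).
have -> : cos z * (x + q - x) - q * cos x = q * (cos z - cos x) by ring.
rewrite normrM -[q ^+ 2]ger0_norm ?sqr_ge0// normrX expr2 ler_wpM2l//.
apply: (le_trans (cos_lip _ _)); apply: (le_trans hz).
by rewrite addrC addKr.
Qed.

(** Moving the window of summation by h changes at most 2 h terms. *)
Lemma sum_shift_bound (u : nat -> R) h N : (forall n, `|u n| <= 1) ->
  `|\sum_(n < N) u (n + h)%N - \sum_(n < N) u n| <= (2 * h)%:R.
Proof.
move=> u1; elim: h => [|h IH].
  by under eq_bigr do rewrite addn0; rewrite subrr normr0.
have -> : \sum_(n < N) u (n + h.+1)%N - \sum_(n < N) u n =
   (\sum_(n < N) u (n + h)%N - \sum_(n < N) u n) + (u (N + h)%N - u h).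
  have : \sum_(n < N.+1) u (n + h)%N = \sum_(n < N.+1) u (n + h)%N by [].
  rewrite {1}big_ord_recl big_ord_recr /= add0n => e.
  have -> : \sum_(n < N) u (n + h.+1)%N = \sum_(i < N) u (bump 0 i + h)%N.
    by apply: eq_bigr => i _; rewrite /bump /= addnS addSn.
  by lra.
rewrite mulnS natrD addrC (le_trans (ler_normD _ _))// lerD//.
rewrite (le_trans (ler_normB _ _))//.
have h1 := u1 (N + h)%N; have h2 := u1 h; lra.
Qed.

Fixpoint dif (hs : seq nat) (f : nat -> R) : nat -> R :=
  if hs is h :: hs' then fun n => dif hs' f (n + h)%N - dif hs' f n else f.

(** Uniformity over the family G is essential: the coefficients of the phases
will depend on frequencies that vary with N. *)
Definition unif_small (G : set (nat -> R)) := forall e, 0 < e ->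
  exists N1, forall N P, (N1 <= N)%N -> G P ->
    `|\sum_(n < N) cos (P n)| <= e * N%:R.

Lemma sqr_sum_le (u : nat -> R) N :
  (\sum_(n < N) u n) ^+ 2 <= N%:R * \sum_(n < N) (u n) ^+ 2.
Proof.
elim: N => [|N IH]; first by rewrite !big_ord0 expr0n mulr0.
rewrite !big_ord_recr /=.
have [->|N0] := posnP N; first by rewrite !big_ord0 !add0r mul1r.
set A := \sum_(_ < _) _ in IH *.
set B := \sum_(_ < _) _ in IH *; set x := u N.
have B0 : 0 <= B by apply: sumr_ge0 => i _; exact: sqr_ge0.
have n0 : 0 < N%:R :> R by rewrite ltr0n.
rewrite -natr1.
have : 0 <= (A - N%:R * x) ^+ 2 by exact: sqr_ge0.
have h : N%:R * ((A + x) ^+ 2) <= N%:R * ((N%:R + 1) * (B + x ^+ 2)) ->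
   (A + x) ^+ 2 <= (N%:R + 1) * (B + x ^+ 2) by rewrite ler_pM2l.
move=> h2; apply: h; set m := N%:R in h2 IH n0 *.
have : (m + 1) * A ^+ 2 <= (m + 1) * (m * B) by rewrite ler_wpM2l// addr_ge0// ltW.
nra.
Qed.

Lemma window_energy (P : nat -> R) H n :
  (\sum_(h < H) cos (P (n + h)%N)) ^+ 2 <=
  \sum_(h < H) \sum_(k < H) cos (P (n + h)%N - P (n + k)%N).
Proof.
have -> : \sum_(h < H) \sum_(k < H) cos (P (n + h)%N - P (n + k)%N) =
   (\sum_(h < H) cos (P (n + h)%N)) ^+ 2 + (\sum_(h < H) sin (P (n + h)%N)) ^+ 2.
  rewrite !expr2 !mulr_suml -big_split /=; apply: eq_bigr => h _.
  rewrite !mulr_sumr -big_split /=; apply: eq_bigr => k _.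
  by rewrite cosB.
by rewrite lerDl sqr_ge0.
Qed.

(** Cauchy-Schwarz over n, then expansion of the square: the diagonal terms give
H N, and a pair of shifts h, k gives a cosine sum for the difference of P with
step h - k. *)
Lemma vdc_ineq (P : nat -> R) (H N : nat) (e : R) :
  0 <= e ->
  (forall h, (0 < h)%N -> (h < H)%N ->
     `|\sum_(n < N) cos (dif [:: h] P n)| <= e * N%:R) ->
  (\sum_(n < N) \sum_(h < H) cos (P (n + h)%N)) ^+ 2 <=
    N%:R * (H%:R * N%:R + H%:R ^+ 2 * (e * N%:R + (2 * H)%:R)).
Proof.
move=> e0 hP; idtac. apply: (le_trans (sqr_sum_le (fun n => \sum_(h < H) cos (P (n + h)%N)) N)); rewrite ler_wpM2l//.
apply: (le_trans (ler_sum _ (fun (n : 'I_N) _ => window_energy P H n))).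
rewrite exchange_big /=; under eq_bigr do rewrite exchange_big /=.
have key (h k : 'I_H) : \sum_(n < N) cos (P (n + h)%N - P (n + k)%N) <=
   (if h == k then N%:R else 0) + (e * N%:R + (2 * H)%:R).
  case: eqP => [->|hk].
    rewrite -[leLHS]addr0 lerD ?addr_ge0 ?mulr_ge0//.
    under eq_bigr do rewrite subrr cos0.
    by rewrite sumr_const card_ord.
  rewrite add0r; wlog kh : h k hk / (k < h)%N.
    move=> w; have [kh|hk'|/val_inj//] := ltngtP h k; last exact: w.
    under eq_bigr do rewrite -opprB cosN.
    apply: (w k h _ kh); exact: nesym.
  have -> : \sum_(n < N) cos (P (n + h)%N - P (n + k)%N) =
     \sum_(n < N) cos (dif [:: (h - k)%N] P (n + k)%N).
    by apply: eq_bigr => n _ /=; congr (cos (P _ - _)); lia.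
  have := @sum_shift_bound (fun n => cos (dif [:: (h - k)%N] P n)) k N (fun=> cos_max _).
  rewrite ler_norml lerBlDr => /andP[_ /le_trans]; apply.
  rewrite addrC lerD//; last by rewrite ler_nat leq_pmul2l// ltnW.
  apply: (le_trans (ler_norm _)); apply: hP; first by rewrite subn_gt0.
  by rewrite (leq_ltn_trans (leq_subr _ _)).
apply: (@le_trans _ _ (\sum_(h < H) \sum_(k < H) ((if h == k then N%:R else 0) + (e * N%:R + (2 * H)%:R)))).
  by apply: ler_sum => h _; apply: ler_sum => k _; exact: key.
under eq_bigr => h _.
  rewrite big_split /= -big_mkcond /= (eq_bigl (pred1 h)); last first.
    by move=> k /=; rewrite eq_sym.
  rewrite big_pred1_eq sumr_const card_ord.
  over.
rewrite big_split /= !sumr_const !card_ord -mulrnA -[X in X + _ <= _]mulr_natl.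
by rewrite -[X in _ + X <= _]mulr_natl natrM expr2.
Qed.

(** The sum of cos (P n) is, up to a bounded error, the mean over the shifts h
< H of the shifted sums, to which [vdc_ineq] applies. *)
Lemma van_der_corput (G : set (nat -> R)) :
  (forall h, (0 < h)%N -> unif_small [set dif [:: h] P | P in G]) ->
  unif_small G.
Proof.
move=> hG e e0.
(* H e^2 > 12 contradicts H^2 e^2 N^2 / 4 <= B^2 <= 3 H N^2, where B is the
   double sum *)
pose H := (Num.truncn (12 / e ^+ 2)).+1.
have H0 : 0 < H%:R :> R by rewrite ltr0n.
have He : 12 < H%:R * e ^+ 2.
  by rewrite -ltr_pdivrMr ?exprn_gt0//; exact: truncnS_gt.
have [h|N0 hN0] := @common_threshold _ (iota 1 H) (fun h N => forall P, G P ->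
    `|\sum_(n < N) cos (dif [:: h] P n)| <= H%:R^-1 * N%:R).
  rewrite mem_iota => /andP[h0 _].
  have [|N1 hN1] := hG h h0 H%:R^-1; first by rewrite invr_gt0.
  by exists N1 => N NN P GP; apply: hN1 => //; exists P.
exists (maxn N0 (maxn (2 * H ^ 2) (Num.truncn (4 * H%:R / e)).+1)) => N P.
rewrite !geq_max => /and3P[NN0 NH NHe] GP.
have N_gt0 : 0 < N%:R :> R by rewrite ltr0n (leq_trans _ NHe).
have NHe' : 4 * H%:R < N%:R * e.
  by rewrite -ltr_pdivrMr// (lt_le_trans (truncnS_gt _))// ler_nat.
have NH' : 2 * H%:R ^+ 2 <= N%:R :> R by rewrite -natrX -natrM ler_nat.
have H1 : 0 <= H%:R^-1 :> R by rewrite invr_ge0 ltW.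
have := @vdc_ineq P H N H%:R^-1 H1 _.
have hh h : (0 < h)%N -> (h < H)%N ->
    `|\sum_(n < N) cos (dif [:: h] P n)| <= H%:R^-1 * N%:R.
  by move=> h0 hH; apply: hN0 => //; rewrite mem_iota h0 add1n ltnS ltnW.
move=> /(_ hh){hh}.
set B := \sum_(n < N) _.
have -> : N%:R * (H%:R * N%:R + H%:R ^+ 2 * (H%:R^-1 * N%:R + (2 * H)%:R)) =
   2 * H%:R * N%:R ^+ 2 + N%:R * H%:R * (2 * H%:R ^+ 2) :> R.
  by rewrite natrM; field; rewrite gt_eqF.
move=> hB.
have BA : `|B - H%:R * \sum_(n < N) cos (P n)| <= 2 * H%:R ^+ 2.
  rewrite /B exchange_big /=.
  have -> : H%:R * \sum_(n < N) cos (P n) = \sum_(h < H) \sum_(n < N) cos (P n).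
    by rewrite sumr_const card_ord mulr_natl.
  rewrite -sumrB (le_trans (ler_norm_sum _ _ _))//.
  apply: (@le_trans _ _ (\sum_(h < H) (2 * H%:R))).
    apply: ler_sum => h _.
    apply: (le_trans (@sum_shift_bound (fun n => cos (P n)) h N (fun=> cos_max _))).
    by rewrite -natrM ler_nat leq_pmul2l// ltnW.
  by rewrite sumr_const card_ord -[X in X <= _]mulr_natl expr2 mulrCA.
rewrite leNgt; apply/negP => hA.
set A := \sum_(n < N) cos (P n) in hA BA.
have hB2 : B ^+ 2 <= 3 * H%:R * N%:R ^+ 2.
  apply: (le_trans hB).
  have : N%:R * H%:R * (2 * H%:R ^+ 2) <= N%:R * H%:R * N%:R :> R.
    by rewrite ler_wpM2l// mulr_ge0// ltW.
  nra.
have B1 : H%:R * e * N%:R / 2 <= `|B|.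
  have : `|H%:R * A| <= `|B| + 2 * H%:R ^+ 2.
    have -> : H%:R * A = B - (B - H%:R * A) by ring.
    by rewrite (le_trans (ler_normB _ _))// lerD2l.
  rewrite normrM gtr0_norm//.
  have : H%:R * (e * N%:R) < H%:R * `|A| by rewrite ltr_pM2l.
  nra.
have : (H%:R * e * N%:R / 2) ^+ 2 <= B ^+ 2.
  rewrite -(real_normK (num_real B)) ler_sqr ?nnegrE//.
  by rewrite divr_ge0// !mulr_ge0// ltW.
move=> /le_trans/(_ hB2).
have -> : (H%:R * e * N%:R / 2) ^+ 2 = (H%:R * N%:R ^+ 2) * (H%:R * e ^+ 2 / 4) by field.
have -> : 3 * H%:R * N%:R ^+ 2 = (H%:R * N%:R ^+ 2) * 3 :> R by ring.
rewrite ler_pM2l ?mulr_gt0 ?exprn_gt0//; lra.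
Qed.

Lemma mulr_powRB1_gt0 (x b : R) : 0 < x -> x * x `^ (b - 1) = x `^ b.
Proof.
move=> x0; rewrite -{1}(powRr1 (ltW x0)) -powRD ?(gt_eqF x0) ?implybT//.
by congr (_ `^ _); ring.
Qed.

Lemma powR_large (a B : R) : 0 < a ->
  exists N, forall n, (N <= n)%N -> B <= n%:R `^ a.
Proof.
move=> a0; exists (Num.truncn (`|B| `^ a^-1)).+1 => n Nn.
rewrite (le_trans (ler_norm B))//.
have -> : `|B| = (`|B| `^ a^-1) `^ a.
  by rewrite -powRrM mulVf ?gt_eqF// powRr1.
apply: ge0_ler_powR; rewrite ?nnegrE ?powR_ge0 ?(ltW a0)// ltW//.
by rewrite (lt_le_trans (truncnS_gt _))// ler_nat.
Qed.

Lemma powR_small (b e : R) : b < 0 -> 0 < e ->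
  exists N, forall n, (N <= n)%N -> n%:R `^ b <= e.
Proof.
move=> b0 e0; have [|N hN] := @powR_large (- b) e^-1; first by rewrite oppr_gt0.
exists N => n /hN h; rewrite -[b]opprK powRN -[e]invrK lef_pV2 ?posrE ?invr_gt0//.
by rewrite (lt_le_trans _ h)// invr_gt0.
Qed.

(** The increments of v telescope and leave only its values at n0 and N, which
are small compared with N. *)
Lemma sum_cos_telescope (P v : nat -> R) (n0 N : nat) (eta : R) : 0 <= eta ->
  (n0 <= N)%N ->
  (forall n, (n0 <= n)%N -> `|cos (P n) - (v n.+1 - v n)| <= eta) ->
  (forall n, (n0 <= n)%N -> `|v n| <= eta * n%:R) ->
  `|\sum_(n < N) cos (P n)| <= n0%:R + 3 * eta * N%:R.
Proof.
move=> eta0 /subnKC <- hP hv; set M := (N - n0)%N.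
have main m : `|\sum_(n < m) cos (P (n0 + n)%N) - (v (n0 + m)%N - v n0)| <= eta * m%:R.
  elim: m => [|m IH]; first by rewrite big_ord0 addn0 subrr subr0 normr0 mulr0.
  rewrite big_ord_recr /= -natr1 mulrDr mulr1 addnS.
  have -> : \sum_(i < m) cos (P (n0 + i)%N) + cos (P (n0 + m)%N) - (v (n0 + m).+1 - v n0) =
    (\sum_(i < m) cos (P (n0 + i)%N) - (v (n0 + m)%N - v n0)) +
    (cos (P (n0 + m)%N) - (v (n0 + m).+1 - v (n0 + m)%N)) by ring.
  by rewrite (le_trans (ler_normD _ _))// lerD// hP// leq_addr.
rewrite big_split_ord /= (le_trans (ler_normD _ _))// lerD//.
  rewrite (le_trans (ler_norm_sum _ _ _))//.
  rewrite (le_trans (ler_sum _ (fun (i : 'I_n0) _ => cos_max _)))//.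
  by rewrite sumr_const card_ord.
have := main M; have := hv _ (leqnn n0); have := hv (n0 + M)%N (leq_addr _ _).
set A := \sum_(_ < M) _; rewrite natrD => h1 h2 h3.
have -> : A = (A - (v (n0 + M)%N - v n0)) + (v (n0 + M)%N - v n0) by ring.
apply: (le_trans (ler_normD _ _)).
have := ler_normB (v (n0 + M)%N) (v n0).
have : 0 <= eta * n0%:R by rewrite mulr_ge0.
have : 0 <= eta * M%:R by rewrite mulr_ge0.
lra.
Qed.

(** The falling factorial of a real number: the coefficient produced by r
differentiations of x `^ a. *)
Definition falling (a : R) (r : nat) : R := \prod_(i < r) (a - i%:R).

Definition lprod (hs : seq nat) : nat := (\prod_(h <- hs) h)%N.

(** Each P behaves, together with all its iterated differences, like lam n^a.
The thresholds T and the bounds on lam are common to the family, which makes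
the class suitable for uniform estimates; the list of steps is required to be
nonempty because the value of P itself may include an arbitrary constant. *)
Definition power_like (a : R) (G : set (nat -> R)) :=
  exists (d C : R) (T : seq nat -> R -> nat), 0 < d /\
    forall P, G P -> exists lam, d <= `|lam| <= C /\
      forall hs e n, hs != [::] -> all (ltn 0) hs -> 0 < e -> (T hs e <= n)%N ->
        `|dif hs P n - lam * falling a (size hs) * (lprod hs)%:R *
                         n%:R `^ (a - (size hs)%:R)|
          <= e * n%:R `^ (a - (size hs)%:R).

Lemma near_lower (l q u : R) : `|q - l| <= u -> 2 * u <= `|l| -> u <= `|q|.
Proof. by move=> h1 h2; have := lerB_dist l q; rewrite distrC; lra. Qed.

Lemma near_upper (l q u : R) : `|q - l| <= u -> `|q| <= `|l| + u.
Proof. by move=> h1; have := lerB_dist q l; lra. Qed.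

(** The increment q n of P is of order n^(a - 1): it tends to 0, but n q n tends
to infinity. The second difference is of order n^(a - 2). So, with
v n = sin (P n) / q n, the increment of v is cos (P n) up to o(1), and v n is
o(n): [sum_cos_telescope] applies. *)
Lemma unif_small_base (a : R) G : 0 < a -> a < 1 -> power_like a G ->
  unif_small G.
Proof.
move=> a0 a1 [d [C [T [d0 hG]]]] e e0.
pose c := d * a / 2; have c0 : 0 < c by rewrite divr_gt0// mulr_gt0.
pose C1 := `|C| * a + c; have C10 : 0 < C1 by rewrite ltr_wpDl// mulr_ge0// ltW.
pose C2 := `|C| * `|a * (a - 1)| + 1.
have C20 : 0 < C2 by rewrite ltr_wpDl// mulr_ge0.
pose eta := e / 6; have eta0 : 0 < eta by rewrite divr_gt0.
have e1 : 0 < eta / 2 / C1 by apply: divr_gt0 => //; apply: divr_gt0.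
have a1' : a - 1 < 0 by rewrite subr_lt0.
have [M1 hM1] := powR_small a1' e1.
have [M2 hM2] := @powR_large a (Num.max (c * eta)^-1 (4 * C2 / (c ^+ 2 * eta))) a0.
pose n0 := maxn (maxn M1 M2) (maxn 1 (maxn (T [:: 1%N] c) (T [:: 1%N; 1%N] 1))).
exists (maxn n0 (Num.truncn (n0%:R / (e / 2))).+1) => N P.
rewrite geq_max => /andP[n0N NN] GP.
have [lam [/andP[dl lC] hl]] := hG P GP.
pose q n := dif [:: 1%N] P n.
have lp1 : lprod [:: 1%N] = 1%N by rewrite /lprod big_seq1.
have lp2 : lprod [:: 1%N; 1%N] = 1%N by rewrite /lprod big_cons big_seq1.
have f1 : falling a 1 = a by rewrite /falling big_ord1 subr0.
have f2 : falling a 2 = a * (a - 1) by rewrite /falling big_ord_recl big_ord1 subr0.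
have lC' : `|lam| <= `|C| by rewrite (le_trans lC)// ler_norm.
have hq n : (n0 <= n)%N -> [/\ c * n%:R `^ (a - 1) <= `|q n|,
     `|q n| <= C1 * n%:R `^ (a - 1) & `|q n.+1 - q n| <= C2 * n%:R `^ (a - 2)].
  rewrite !geq_max => /and3P[_ _ /andP[T1 T2]].
  have := hl [:: 1%N] c n isT isT c0 T1.
  rewrite -[dif _ _ _]/(q n) lp1 f1 mulr1 /=.
  have := hl [:: 1%N; 1%N] 1 n isT isT ltr01 T2.
  rewrite -[dif _ _ _]/(q (n + 1)%N - q n) lp2 f2 mulr1 mul1r addn1 /=.
  set X := n%:R `^ (a - 1); set Y := n%:R `^ (a - 2) => h2 h1.
  have X0 : 0 <= X by exact: powR_ge0.
  have Y0 : 0 <= Y by exact: powR_ge0.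
  have nl : `|lam * a * X| = `|lam| * a * X.
    by rewrite !normrM (gtr0_norm a0) (ger0_norm X0).
  have daX : d * a * X <= `|lam| * a * X by rewrite !ler_wpM2r// ltW.
  have CaX : `|lam| * a * X <= `|C| * a * X by rewrite !ler_wpM2r// ltW.
  split.
  - apply: near_lower h1 _; rewrite nl (le_trans _ daX)//.
    by rewrite le_eqVlt /c; apply/orP; left; apply/eqP; field.
  - by apply: (le_trans (near_upper h1)); rewrite nl /C1 mulrDl lerD2r.
  - apply: (le_trans (near_upper h2)); rewrite /C2 mulrDl mul1r lerD2r.
    by rewrite 2![in leLHS]normrM (ger0_norm Y0) !ler_wpM2r.
have n0_gt0 n : (n0 <= n)%N -> (0 < n)%N by rewrite !geq_max => /and3P[_ ? _].
have hpow n : (n0 <= n)%N -> (c * eta)^-1 <= n%:R `^ a /\ 4 * C2 / (c ^+ 2 * eta) <= n%:R `^ a.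
  rewrite !geq_max => /and3P[/andP[_ /hM2]] + _ _.
  by rewrite ge_max => /andP[].
pose v n := sin (P n) / q n.
have hv n : (n0 <= n)%N -> `|v n| <= eta * n%:R.
  move=> nn; have [q1 _ _] := hq n nn; have np := n0_gt0 _ nn.
  have n_gt0 : 0 < n%:R :> R by rewrite ltr0n.
  have X0 : 0 < n%:R `^ (a - 1) by rewrite powR_gt0.
  have q0 : 0 < `|q n| by apply: lt_le_trans q1; rewrite mulr_gt0.
  rewrite normrM normfV ler_pdivrMr// (le_trans (sin_max _))//.
  rewrite (@le_trans _ _ (eta * n%:R * (c * n%:R `^ (a - 1))))//; last first.
    by rewrite ler_wpM2l// mulr_ge0// ltW.
  have -> : eta * n%:R * (c * n%:R `^ (a - 1)) = c * eta * (n%:R * n%:R `^ (a - 1)) by ring.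
  rewrite mulr_powRB1// -ler_pdivrMl ?mulr_gt0// mulr1.
  by case: (hpow n nn).
have hcos n : (n0 <= n)%N -> `|cos (P n) - (v n.+1 - v n)| <= eta.
  move=> nn; have [q1 q2 q3] := hq n nn; have np := n0_gt0 _ nn.
  have [q1' _ _] := hq n.+1 (leqW nn).
  have n_gt0 : 0 < n%:R :> R by rewrite ltr0n.
  have n1_gt0 : 0 < n.+1%:R :> R by rewrite ltr0n.
  have X0 : 0 < n%:R `^ (a - 1) by rewrite powR_gt0.
  have X'0 : 0 < n.+1%:R `^ (a - 1) by rewrite powR_gt0.
  have q0 : 0 < `|q n| by apply: lt_le_trans q1; rewrite mulr_gt0.
  have q'0 : 0 < `|q n.+1| by apply: lt_le_trans q1'; rewrite mulr_gt0.
  have qn0 : q n != 0 by rewrite -normr_gt0.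
  have q'n0 : q n.+1 != 0 by rewrite -normr_gt0.
  have PE : P n.+1 = P n + q n by rewrite /q /= addn1; ring.
  (* the Taylor error of the sine, and the variation of 1 / q *)
  have -> : cos (P n) - (v n.+1 - v n) =
     - (sin (P n + q n) - sin (P n) - q n * cos (P n)) / q n +
     sin (P n.+1) * ((q n.+1 - q n) / (q n * q n.+1)).
    by rewrite /v PE; field; rewrite qn0 q'n0.
  rewrite (le_trans (ler_normD _ _))// (splitr eta) lerD//.
    rewrite normrM normrN normfV ler_pdivrMr//.
    apply: (le_trans (sin_taylor _ _)).
    rewrite -(real_normK (num_real (q n))) expr2 ler_wpM2r// (le_trans q2)//.
    rewrite mulrC -ler_pdivlMr//; apply: hM1.
    by move: nn; rewrite !geq_max => /andP[/andP[]].
  rewrite normrM; apply: (le_trans (ler_wpM2r (normr_ge0 _) (sin_max _))).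
  rewrite mul1r.
  rewrite normrM normfV normrM ler_pdivrMr ?mulr_gt0//.
  apply: (le_trans q3).
  apply: (@le_trans _ _ (eta / 2 * (c * n%:R `^ (a - 1) * (c * n.+1%:R `^ (a - 1))))); last first.
    apply: ler_wpM2l; first by rewrite divr_ge0// ltW.
    by apply: ler_pM => //; apply: mulr_ge0; apply: ltW.
  have [_] := hpow n.+1 (leqW nn); rewrite -mulr_powRB1//.
  have -> : n%:R `^ (a - 1) = n%:R * n%:R `^ (a - 2).
    by rewrite -(mulr_powRB1_gt0 (a - 1))//; congr (_ * _ `^ _); ring.
  have Y0 : 0 < n%:R `^ (a - 2) by rewrite powR_gt0.
  move: X'0 Y0; set X' := n.+1%:R `^ _; set Y := n%:R `^ _ => X'0 Y0.
  rewrite ler_pdivrMr ?mulr_gt0 ?exprn_gt0// => h.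
  have n1n : n.+1%:R <= 2 * n%:R :> R by rewrite -natrM ler_nat mul2n -addnn -addn1 leq_add2l.
  have h3 : 2 * (2 * C2) <= 2 * (n%:R * X' * (c ^+ 2 * eta)).
    have -> : 2 * (2 * C2) = 4 * C2 by ring.
    have -> : 2 * (n%:R * X' * (c ^+ 2 * eta)) = 2 * n%:R * X' * (c ^+ 2 * eta) by ring.
    apply: (le_trans h); apply: ler_wpM2r.
      by apply: mulr_ge0; [exact: sqr_ge0|exact: ltW].
    by apply: ler_wpM2r => //; exact: ltW.
  have -> : eta / 2 * (c * (n%:R * Y) * (c * X')) = n%:R * X' * (c ^+ 2 * eta) / 2 * Y by field.
  rewrite ler_wpM2r ?(ltW Y0)// ler_pdivlMr// mulrC.
  by move: h3; rewrite ler_pM2l.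
apply: (le_trans (sum_cos_telescope (ltW eta0) n0N hcos hv)).
have : n0%:R <= e / 2 * N%:R.
  rewrite mulrC -ler_pdivrMr ?divr_gt0//.
  by rewrite ltW// (lt_le_trans (truncnS_gt _))// ler_nat.
have -> : 3 * eta = e / 2 by rewrite /eta; field.
by move=> h; apply: (le_trans (lerD h (lexx _))); rewrite -mulrDl -splitr.
Qed.

End Weyl.

(** * Iterated differences of a power *)

Section Powers.
Variable R : realType.

Lemma dif_rcons hs h (P : nat -> R) n : dif hs (dif [:: h] P) n = dif (rcons hs h) P n.
Proof. by elim: hs n => //= h' hs IH n; rewrite !IH. Qed.

Lemma dif_cat hs hs' (P : nat -> R) n : dif hs (dif hs' P) n = dif (hs ++ hs') P n.
Proof. by elim: hs n => //= h' hs IH n; rewrite !IH. Qed.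

Lemma fallingS (a : R) r : falling a r.+1 = a * falling (a - 1) r.
Proof.
rewrite /falling big_ord_recl subr0; congr (_ * _); apply: eq_bigr => i _.
by rewrite lift0 -natr1; ring.
Qed.

(** Differencing multiplies lam by a h and lowers the exponent by one. *)
Lemma power_like_dif (a : R) G h : 0 < a -> (0 < h)%N ->
  power_like a G -> power_like (a - 1) [set dif [:: h] P | P in G].
Proof.
move=> a0 h0 [d [C [T [d0 hG]]]].
have h0' : 0 < h%:R :> R by rewrite ltr0n.
exists (d * (a * h%:R)), (C * (a * h%:R)), (fun hs e => T (rcons hs h) e); split.
  by rewrite !mulr_gt0.
move=> _ [P GP <-]; have [lam [/andP[dl lC] hl]] := hG P GP.
exists (lam * (a * h%:R)); split.
  rewrite normrM (gtr0_norm (mulr_gt0 a0 h0')) !ler_wpM2r//; by rewrite mulr_ge0// ltW.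
move=> hs e n hs0 hsp e0 Tn; rewrite dif_rcons.
have := hl (rcons hs h) e n _ _ e0 Tn; rewrite size_rcons.
have hn : rcons hs h != [::] by case: (hs).
have hr : all (ltn 0) (rcons hs h) by rewrite all_rcons /= h0.
move=> /(_ hn hr).
have -> : lprod (rcons hs h) = (lprod hs * h)%N.
  by rewrite /lprod -cats1 big_cat big_seq1.
rewrite fallingS natrM -natr1.
have -> : a - ((size hs)%:R + 1) = a - 1 - (size hs)%:R by ring.
congr (`|_ - _| <= _); ring.
Qed.

(** Van der Corput differencing lowers the exponent until it lies in (0, 1);
it never becomes an integer, so the leading coefficient never vanishes. *)
Lemma weyl (a : R) G : 0 < a -> a \isn't a Num.nat -> power_like a G ->
  unif_small G.
Proof.
have [m] : exists m : nat, a < m%:R.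
  by exists (Num.truncn a).+1; exact: truncnS_gt.
elim: m a G => [|m IH] a G am a0 aN pG.
  by move: (lt_trans a0 am); rewrite ltxx.
have [a1|a1|a1] := ltgtP a 1; last by rewrite a1 rpred1 in aN.
  exact: unif_small_base pG.
apply: van_der_corput => h h0; apply: (IH (a - 1)).
- by move: am; rewrite -natr1; lra.
- by rewrite subr_gt0.
- apply/negP => hn; move/negP: aN; apply.
  by rewrite -(subrK 1 a) rpredD// rpred1.
- exact: power_like_dif.
Qed.

Fixpoint difR (hs : seq nat) (f : R -> R) : R -> R :=
  if hs is h :: hs' then fun x => difR hs' f (x + h%:R) - difR hs' f x else f.

Lemma dif_difR hs f n : dif hs (fun n => f n%:R) n = difR hs f n%:R.
Proof. by elim: hs n => //= h hs IH n; rewrite !IH natrD. Qed.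

Lemma is_derive_difR hs (f f' : R -> R) :
  (forall x : R, 0 < x -> is_derive x 1 f (f' x)) ->
  forall x : R, 0 < x -> is_derive x 1 (difR hs f) (difR hs f' x).
Proof.
move=> hf; elim: hs => //= h hs IH x x0.
have h1 := IH x x0.
have h2 : is_derive (x + h%:R) 1 (difR hs f) (difR hs f' (x + h%:R)).
  by apply: IH; rewrite ltr_wpDr.
have [sd sv] : is_derive x (1 : R) (shift (h%:R : R)) (1 : R).
  exact: is_derive_shift.
have h3 : is_derive x 1 (difR hs f \o (shift h%:R)) (difR hs f' (x + h%:R)).
  have [fd fv] := h2; split.
    exact/derivable1_diffP/differentiable_comp/derivable1_diffP/fd/derivable1_diffP/sd.
  have := @derive1_comp R (shift (h%:R : R)) (difR hs f) x sd fd.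
  by rewrite !derive1E fv sv mulr1.
exact: (@is_deriveB _ _ _ _ _ _ _ _ _ h3 h1).
Qed.

Lemma difR_scale hs (k : R) (f : R -> R) x :
  difR hs (fun y => k * f y) x = k * difR hs f x.
Proof. by elim: hs x => //= h hs IH x; rewrite !IH mulrBr. Qed.

(** A mean value theorem for iterated differences: a difference of a power is
a difference of fewer steps of the power with exponent one less, at an
intermediate point. *)
Lemma difR_powR hs (a x : R) : 0 < x ->
  exists2 z, x <= z <= x + (sumn hs)%:R &
    difR hs (fun y : R => y `^ a) x = falling a (size hs) * (lprod hs)%:R * z `^ (a - (size hs)%:R).
Proof.
elim: hs a x => [|h hs IH] a x x0 /=.
  exists x; first by rewrite addr0 lexx.
  by rewrite /falling big_ord0 /lprod big_nil !mul1r subr0.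
have dF (y : R) : 0 < y -> is_derive y 1 (difR hs (fun y : R => y `^ a))
     (difR hs (fun z => a * z `^ (a - 1)) y).
  by apply: is_derive_difR => z z0; exact: is_derive1_powR.
have [|||y + e] := @MVT_segment R (difR hs (fun y : R => y `^ a))
    (difR hs (fun z => a * z `^ (a - 1))) x (x + h%:R).
- by rewrite lerDl.
- move=> y; rewrite in_itv /= => /andP[xy _]; apply: dF; exact: lt_trans xy.
- apply: derivable_within_continuous => y; rewrite in_itv /= => /andP[xy _].
  have [//] := dF y (lt_le_trans x0 xy).
rewrite in_itv /= => /andP[xy yx]; have y0 := lt_le_trans x0 xy.
have [z /andP[yz zy] ez] := IH (a - 1) y y0.
exists z.
  rewrite (le_trans xy yz) (le_trans zy)// natrD addrA lerD2r//.
rewrite e addrAC subrr add0r difR_scale ez fallingS /lprod big_cons natrM -natr1.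
have -> : a - 1 - (size hs)%:R = a - ((size hs)%:R + 1) by ring.
ring.
Qed.

(** A bounded displacement of the argument changes a power by a relative error
O(1/n). *)
Lemma powR_near (b : R) (s : nat) (e : R) : 0 < e ->
  exists N, forall n z, (N <= n)%N -> n%:R <= z <= n%:R + s%:R ->
    `|z `^ b - n%:R `^ b| <= e * n%:R `^ b.
Proof.
(* as n <= z <= 2 n, the (b-1)-th powers have a ratio at most 2^|b-1| *)
move=> e0; pose K := `|b| * s%:R * 2 `^ `|b - 1|.
exists (maxn 1 (maxn s (Num.truncn (K / e)).+1)) => n z.
rewrite !geq_max => /and3P[n_gt0 sn Kn] /andP[nz zs].
have n0 : 0 < n%:R :> R by rewrite ltr0n.
have [||y + ->] := @MVT_segment R (fun y : R => y `^ b) (fun y => b * y `^ (b - 1)) n%:R z nz.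
- move=> y; rewrite in_itv /= => /andP[xy _]; apply: is_derive1_powR; exact: lt_trans xy.
- apply: derivable_within_continuous => y; rewrite in_itv /= => /andP[xy _].
  have [//] := is_derive1_powR b (lt_le_trans n0 xy).
rewrite in_itv /= => /andP[ny yz]; have y0 := lt_le_trans n0 ny.
have y2 : y <= 2 * n%:R.
  have : s%:R <= n%:R :> R by rewrite ler_nat.
  lra.
have hy : y `^ (b - 1) <= 2 `^ `|b - 1| * n%:R `^ (b - 1).
  have [b1|b1] := leP 0 (b - 1).
    rewrite (ger0_norm b1) -powRM//.
    by apply: ge0_ler_powR; rewrite ?nnegrE// ?mulr_ge0// ltW.
  rewrite (@le_trans _ _ (n%:R `^ (b - 1)))//.
    rewrite -[b - 1]opprK (powRN y) (powRN n%:R) lef_pV2 ?posrE ?powR_gt0//.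
    by apply: ge0_ler_powR; rewrite ?nnegrE ?oppr_ge0// ltW.
  by rewrite ler_peMl ?powR_ge0// -[leLHS](powRr0 (2 : R)) ler_powR// ler1n.
rewrite !normrM (ger0_norm (powR_ge0 _ _)).
have zn : `|z - n%:R| <= s%:R by rewrite ger0_norm ?subr_ge0//; lra.
apply: (@le_trans _ _ (K * n%:R `^ (b - 1))).
  apply: (@le_trans _ _ (`|b| * (2 `^ `|b - 1| * n%:R `^ (b - 1)) * s%:R)).
    by rewrite ler_pM// ?mulr_ge0 ?powR_ge0// ler_wpM2l.
  by rewrite /K le_eqVlt; apply/orP; left; apply/eqP; ring.
rewrite -[in leRHS]mulr_powRB1_gt0// mulrA ler_wpM2r ?powR_ge0//.
rewrite mulrC -ler_pdivrMr// ltW// (lt_le_trans (truncnS_gt _))// ler_nat //.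
Qed.

Lemma dif_powR_asym hs (a e : R) : 0 < e ->
  exists N, forall n, (N <= n)%N ->
    `|dif hs (fun n => n%:R `^ a) n
       - falling a (size hs) * (lprod hs)%:R * n%:R `^ (a - (size hs)%:R)|
    <= e * n%:R `^ (a - (size hs)%:R).
Proof.
move=> e0; pose K := `|falling a (size hs) * (lprod hs)%:R| + 1.
have K0 : 0 < K by rewrite ltr_wpDl.
have [|N hN] := @powR_near (a - (size hs)%:R) (sumn hs) (e / K).
  by rewrite divr_gt0.
exists (maxn 1 N) => n; rewrite geq_max => /andP[n_gt0 Nn].
have n0 : 0 < n%:R :> R by rewrite ltr0n.
rewrite (dif_difR hs (fun y : R => y `^ a)); have [z zn ->] := difR_powR hs a n0.
rewrite -mulrBr normrM.
apply: (le_trans (ler_wpM2l (normr_ge0 _) (hN n z Nn zn))).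
rewrite mulrA ler_wpM2r ?powR_ge0// mulrCA ler_piMr ?(ltW e0)//.
by rewrite ler_pdivrMr// mul1r /K lerDl.
Qed.

End Powers.

(** * Combinations of the differences of n^c *)

Section Phases.
Variable R : realType.

(** In the basis of the forward differences of n^c, (n + j)^c has integral
coefficients by the Newton formula, so that integral parts can be taken
termwise. *)
Definition powdif (c : R) (j : nat) : nat -> R := dif (nseq j 1%N) (fun n => n%:R `^ c).

Lemma fallingD (a : R) r s : falling a (r + s) = falling a r * falling (a - r%:R) s.
Proof.
rewrite /falling big_split_ord /=; congr (_ * _); apply: eq_bigr => i _ /=.
by rewrite natrD opprD addrA.
Qed.

Lemma falling_neq0 (a : R) r : a \isn't a Num.nat -> falling a r != 0.
Proof.
move=> aN; apply/prodf_neq0 => i _; rewrite subr_eq0; apply/eqP => ai.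
by move: aN; rewrite ai natr_nat.
Qed.

Lemma lprod_cat1 hs j : lprod (hs ++ nseq j 1%N) = lprod hs.
Proof.
rewrite /lprod big_cat /= [X in (_ * X)%N]big1_seq ?muln1// => i.
by rewrite mem_nseq => /andP[_ /andP[_ /eqP]].
Qed.

Lemma dif_powdif_asym (c e : R) hs i j : (i <= j)%N -> 0 < e ->
  exists N, forall n, (N <= n)%N ->
   `|dif hs (powdif c j) n - (if j == i then falling c (size hs + i) * (lprod hs)%:R *
        n%:R `^ (c - i%:R - (size hs)%:R) else 0)| <= e * n%:R `^ (c - i%:R - (size hs)%:R).
Proof.
move=> ij e0; have [->|ji] := eqVneq j i.
  have [N hN] := @dif_powR_asym R (hs ++ nseq i 1%N) c e e0.
  exists N => n /hN; rewrite -dif_cat size_cat size_nseq lprod_cat1 natrD.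
  by have -> : c - ((size hs)%:R + i%:R) = c - i%:R - (size hs)%:R by ring.
have lij : (i < j)%N by rewrite ltn_neqAle eq_sym ji.
have [N hN] := @dif_powR_asym R (hs ++ nseq j 1%N) c 1 ltr01.
set F := falling _ _ * _ in hN.
have K0 : 0 < `|F| + 1 by rewrite ltr_wpDl.
have m0 : - (j - i)%:R < 0 :> R by rewrite oppr_lt0 ltr0n subn_gt0.
have [N' hN'] := powR_small m0 (divr_gt0 e0 K0).
exists (maxn 1 (maxn N N')) => n; rewrite !geq_max => /and3P[n_gt0 Nn Nn'].
have n0 : 0 < n%:R :> R by rewrite ltr0n.
rewrite subr0 /powdif dif_cat; have := hN n Nn.
have -> : c - (size (hs ++ nseq j 1%N))%:R = (c - i%:R - (size hs)%:R) + - (j - i)%:R.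
  by rewrite size_cat size_nseq natrD natrB//; ring.
rewrite powRD ?(gt_eqF n0) ?implybT//.
set X := _ `^ (c - i%:R - _); set Z := _ `^ _ => h.
have X0 : 0 <= X by exact: powR_ge0.
have Z0 : 0 <= Z by exact: powR_ge0.
apply: (le_trans (near_upper h)).
rewrite normrM (ger0_norm (mulr_ge0 X0 Z0)) -mulrDl mulrCA mulrC ler_wpM2r//.
by rewrite mulrC -ler_pdivlMr//; exact: hN'.
Qed.

Lemma dif_sum hs (m : nat) (f : nat -> nat -> R) n :
  dif hs (fun n => \sum_(j < m) f j n) n = \sum_(j < m) dif hs (f j) n.
Proof.
elim: hs n => //= h hs IH n; by rewrite !IH -sumrB.
Qed.

Lemma dif_scale hs (k : R) (f : nat -> R) n :
  dif hs (fun n => k * f n) n = k * dif hs f n.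
Proof. by elim: hs n => //= h hs IH n; rewrite !IH mulrBr. Qed.

Lemma dif_cst hs (k : R) (f : nat -> R) n : hs != [::] ->
  dif hs (fun n => k + f n) n = dif hs f n.
Proof.
elim: hs n => //= h [|h' hs] IH n _; first by rewrite /= opprD addrACA subrr add0r.
by rewrite !IH.
Qed.

Definition phase c (d : nat) (g : nat -> R) (phi : R) : nat -> R :=
  fun n => phi + \sum_(j < d.+1) g j * powdif c j n.

(** The first nonzero coefficient governs the growth of the combination, of
order n^(c - i), and must stay away from 0 for uniform estimates. *)
Definition leading (i : nat) (delta C : R) (g : nat -> R) :=
  [/\ forall j, (j < i)%N -> g j = 0, delta <= `|g i| & forall j, `|g j| <= C].

(** The term of index i dominates: a difference of order j > i decays faster
by a factor of order n^(i - j). *)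
Lemma phase_power_like c d i (delta C : R) : (i <= d)%N ->
  c \isn't a Num.nat -> 0 < delta ->
  power_like (c - i%:R)
    [set P | exists g phi, leading i delta C g /\ P = phase c d g phi].
Proof.
move=> id cN d0.
have F0 : 0 < `|falling c i| by rewrite normr_gt0 falling_neq0.
have C0 : 0 < `|C| + 1 by rewrite ltr_wpDl.
have hT (p : seq nat * R) : exists T, 0 < p.2 -> forall j n, (i <= j)%N -> (j < d.+1)%N -> (T <= n)%N ->
   `|dif p.1 (powdif c j) n - (if j == i then falling c (size p.1 + i) * (lprod p.1)%:R *
        n%:R `^ (c - i%:R - (size p.1)%:R) else 0)| <=
     p.2 / (d.+1%:R * (`|C| + 1)) * n%:R `^ (c - i%:R - (size p.1)%:R).
  case: p => hs e /=; have [e0|_] := ltP 0 e; last by exists 0%N.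
  have e1 : 0 < e / (d.+1%:R * (`|C| + 1)) by rewrite divr_gt0// mulr_gt0.
  have [j|N hN] := @common_threshold _ [seq j <- iota 0 d.+1 | (i <= j)%N] (fun j n =>
    `|dif hs (powdif c j) n - (if j == i then falling c (size hs + i) * (lprod hs)%:R *
        n%:R `^ (c - i%:R - (size hs)%:R) else 0)| <=
     e / (d.+1%:R * (`|C| + 1)) * n%:R `^ (c - i%:R - (size hs)%:R)).
    by rewrite mem_filter => /andP[ij _]; exact: dif_powdif_asym.
  exists N => _ j n ij jd Nn; apply: hN => //.
  by rewrite mem_filter ij mem_iota.
have [T hT'] := choice hT.
exists (delta * `|falling c i|), (C * `|falling c i|), (fun hs e => T (hs, e)); split.
  by rewrite mulr_gt0.
move=> _ [g [phi [[g0 gd gC] ->]]]; exists (g i * falling c i); split.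
  by rewrite normrM !ler_wpM2r.
move=> hs e n hs0 _ e0 Tn; rewrite /phase dif_cst// (dif_sum hs d.+1 (fun j n => g j * powdif c j n)).
have h := hT' (hs, e) e0; move: {hT' hT} h => /= h.
set X := _ `^ _; have X0 : 0 <= X by exact: powR_ge0.
have -> : g i * falling c i * falling (c - i%:R) (size hs) * (lprod hs)%:R * X =
   \sum_(j < d.+1) g j * (if j == i :> nat then falling c (size hs + i) * (lprod hs)%:R * X else 0).
  rewrite (bigD1 (Ordinal (id : (i < d.+1)%N)))//= eqxx big1 ?addr0.
    by rewrite addnC fallingD; ring.
  by move=> j ji; rewrite ifF ?mulr0//; apply/negP => /eqP ej; move/eqP: ji; apply; exact: val_inj.
rewrite -sumrB (le_trans (ler_norm_sum _ _ _))//.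
apply: (@le_trans _ _ (\sum_(j < d.+1) (e / d.+1%:R * X))); last first.
  rewrite sumr_const card_ord -mulr_natl.
  by rewrite le_eqVlt; apply/orP; left; apply/eqP; field.
apply: ler_sum => j _; rewrite dif_scale -mulrBr.
have [ji|ij] := ltnP j i.
  by rewrite g0// mul0r normr0 mulr_ge0// divr_ge0// ltW.
rewrite normrM (le_trans (ler_wpM2l (normr_ge0 _) (h j n ij (ltn_ord j) Tn)))//.
rewrite -/X mulrA ler_wpM2r// (@le_trans _ _ ((`|C| + 1) * (e / (d.+1%:R * (`|C| + 1)))))//.
  apply: ler_wpM2r; first by rewrite divr_ge0// ?mulr_ge0// ltW.
  by rewrite (le_trans (gC j))// (le_trans (ler_norm C))// lerDl.
by rewrite le_eqVlt; apply/orP; left; apply/eqP; field; rewrite (gt_eqF C0) nat1r pnatr_eq0.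
Qed.

Lemma phase_unif_small c d i (delta C : R) : (i <= d)%N -> d%:R < c ->
  c \isn't a Num.nat -> 0 < delta ->
  unif_small [set P | exists g phi, leading i delta C g /\ P = phase c d g phi].
Proof.
move=> id dc cN d0; apply: (@weyl R (c - i%:R)).
- by rewrite subr_gt0 (le_lt_trans _ dc)// ler_nat.
- apply/negP => h; move/negP: cN; apply.
  by rewrite -(subrK i%:R c) rpredD// natr_nat.
- exact: phase_power_like.
Qed.

Lemma phase_all_small c d (delta C e : R) : d%:R < c ->
  c \isn't a Num.nat -> 0 < delta -> 0 < e ->
  exists N1, forall N i g phi, (N1 <= N)%N -> (i <= d)%N -> leading i delta C g ->
    `|\sum_(n < N) cos (phase c d g phi n)| <= e * N%:R.
Proof.
move=> dc cN d0 e0.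
have [i|N1 hN1] := @common_threshold _ (iota 0 d.+1) (fun i N => forall g phi, leading i delta C g ->
    `|\sum_(n < N) cos (phase c d g phi n)| <= e * N%:R).
  rewrite mem_iota ltnS => /andP[_ id].
  have [N hN] := @phase_unif_small c d i delta C id dc cN d0 e e0.
  by exists N => n Nn g phi hg; apply: hN => //; exists g, phi.
by exists N1 => N i g phi NN id; apply: hN1 => //; rewrite mem_iota ltnS.
Qed.

(** Newton interpolation; the sum is allowed to extend beyond j because the
extra binomial coefficients vanish. *)
Lemma newton (f : nat -> R) j M n : (j < M)%N ->
  f (n + j)%N = \sum_(i < M) 'C(j, i)%:R * dif (nseq i 1%N) f n.
Proof.
elim: j n M => [|j IH] n [|M]// jM.
  rewrite big_ord_recl /= addn0 mul1r big1 ?addr0// => i _.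
  by rewrite bin0n /= mul0r.
rewrite addnS -addSn -addn1 (IH _ M)// big_ord_recl bin0 mul1r /=.
have dE i : dif (nseq i 1%N) f (n + 1)%N =
    dif (nseq i 1%N) f n + dif (nseq i.+1 1%N) f n by rewrite /=; ring.
under eq_bigr do rewrite dE mulrDr.
rewrite big_split /=; under [in RHS]eq_bigr do rewrite /bump /= add1n binS natrD mulrDl.
rewrite big_split /= addrA; congr (_ + _).
case: M jM => [//|M] jM.
rewrite big_ord_recl bin0 mul1r /=; congr (_ + _).
rewrite [in RHS]big_ord_recr /= bin_small ?mul0r ?addr0//.
Qed.

Lemma powdif_small c d i (e : R) : c < d.+1%:R -> (d < i)%N -> 0 < e ->
  exists N, forall n, (N <= n)%N -> `|powdif c i n| <= e.
Proof.
move=> cd di e0.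
have [N hN] := @dif_powR_asym R (nseq i 1%N) c 1 ltr01.
rewrite size_nseq in hN; set F := falling _ _ * _ in hN.
have K0 : 0 < `|F| + 1 by rewrite ltr_wpDl.
have ci : c - i%:R < 0 by rewrite subr_lt0 (lt_le_trans cd)// ler_nat.
have [N' hN'] := powR_small ci (divr_gt0 e0 K0).
exists (maxn N N') => n; rewrite geq_max => /andP[/hN h /hN' h'].
apply: (le_trans (near_upper h)).
rewrite normrM (ger0_norm (powR_ge0 _ _)) -mulrDl.
by rewrite mulrC -ler_pdivlMr.
Qed.

Lemma bin_le_exp2 j i : ('C(j, i) <= 2 ^ j)%N.
Proof.
elim: j i => [|j IH] [|i]; rewrite ?bin0 ?expn_gt0//.
by rewrite binS expnS mul2n -addnn leq_add.
Qed.

(** Differences of order larger than c tend to 0, so only the first d + 1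
terms of the Newton formula matter. *)
Lemma powR_newton c d L (e : R) : c < d.+1%:R -> 0 < e ->
  exists N, forall n j, (N <= n)%N -> (j <= L)%N ->
    `|(n + j)%:R `^ c - \sum_(i < d.+1) 'C(j, i)%:R * powdif c i n| <= e.
Proof.
move=> cd e0.
pose K : R := (L.+1 * 2 ^ L)%:R.
have K0 : 0 < K by rewrite ltr0n muln_gt0 expn_gt0.
have [i|N hN] := @common_threshold _ [seq i <- iota 0 (d.+1 + L.+1) | (d < i)%N]
    (fun i n => `|powdif c i n| <= e / K).
  rewrite mem_filter => /andP[di _]; apply: powdif_small cd di _.
  by rewrite divr_gt0.
exists N => n j Nn jL.
rewrite (@newton (fun n => n%:R `^ c) j (d.+1 + L.+1)); last first.
  by rewrite ltn_addl// ltnS.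
rewrite big_split_ord /= addrAC subrr add0r (le_trans (ler_norm_sum _ _ _))//.
apply: (@le_trans _ _ (\sum_(i < L.+1) ((2 ^ L)%:R * (e / K)))).
  apply: ler_sum => i _; rewrite normrM ler_pM//.
    rewrite normr_nat ler_nat (leq_trans (bin_le_exp2 _ _))//.
    by rewrite leq_exp2l.
  apply: (hN (d.+1 + i)%N n) => //; rewrite mem_filter mem_iota /=; apply/andP; split.
    by rewrite addSn ltnS leq_addr.
  by rewrite add0n ltn_add2l.
rewrite sumr_const card_ord -[leLHS]mulr_natl /K natrM.
rewrite le_eqVlt; apply/orP; left; apply/eqP; field.
by rewrite !pnatr_eq0 /= expn_eq0 nat1r pnatr_eq0.
Qed.

End Phases.

(** * The Fejer kernel *)

Section Fejer.
Variable R : realType.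

Definition tau : R := 2 * pi.

Lemma tau_gt0 : 0 < tau. Proof. by rewrite mulr_gt0// pi_gt0. Qed.

Lemma cosDtau (x : R) (z : int) : cos (x + tau * z%:~R) = cos x.
Proof.
have natcase (y : R) (n : nat) : cos (y + tau * n%:R) = cos y.
  have -> : tau * n%:R = (pi *+ 2) *+ n by rewrite -mulr_natr -mulr_natr /tau; ring.
  by rewrite (periodicn (@cosD2pi R)).
case: (intP z) => [|n|n]; first by rewrite mulr0 addr0.
  exact: natcase.
by rewrite mulrNz mulrN -[LHS](natcase _ n.+1) subrK.
Qed.

(** Multiplied by 2 sin (theta / 2), each cosine becomes a difference of two
consecutive sines. *)
Lemma cos_sum_telescope (theta phi : R) H :
  2 * sin (theta / 2) * \sum_(h < H) cos (h%:R * theta + phi) =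
  sin (H%:R * theta + phi - theta / 2) - sin (phi - theta / 2).
Proof.
elim: H => [|H IH]; first by rewrite big_ord0 mulr0 mul0r add0r subrr.
rewrite big_ord_recr /= mulrDr IH.
have -> : H.+1%:R * theta + phi - theta / 2 = (H%:R * theta + phi) + theta / 2.
  by rewrite -natr1; field.
rewrite (sinD (H%:R * theta + phi) (theta / 2)) (sinB (H%:R * theta + phi) (theta / 2)); ring.
Qed.

Lemma cos_sum_bound (theta phi : R) H :
  `|sin (theta / 2)| * `|\sum_(h < H) cos (h%:R * theta + phi)| <= 1.
Proof.
have := cos_sum_telescope theta phi H => /(congr1 Num.norm).
rewrite !normrM (ger0_norm (ler0n _ 2)) => h.
have : 2 * `|sin (theta / 2)| * `|\sum_(h < H) cos (h%:R * theta + phi)| <= 2.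
  rewrite h (le_trans (ler_normB _ _))// -[leRHS]/(1 + 1 : R) lerD//; exact: sin_max.
by rewrite -mulrA -[leRHS]mulr1 ler_pM2l.
Qed.

(** The Fejer kernel of mean value 1, as a trigonometric polynomial in x of
period 1. *)
Definition fejer (H : nat) (x : R) : R :=
  H%:R^-1 * \sum_(h < H) \sum_(k < H) cos (tau * ((h%:R - k%:R) * x)).

Lemma fejerE H x : fejer H x =
  H%:R^-1 * ((\sum_(h < H) cos (h%:R * (tau * x) + 0)) ^+ 2 +
             (\sum_(h < H) cos (h%:R * (tau * x) - pi / 2)) ^+ 2).
Proof.
rewrite /fejer; congr (_ * _); rewrite !expr2 !mulr_suml -big_split /=.
apply: eq_bigr => h _; rewrite !mulr_sumr -big_split /=; apply: eq_bigr => k _.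
by rewrite !addr0 !cosBpihalf -cosB; congr cos; ring.
Qed.

Lemma fejer_ge0 H x : 0 <= fejer H x.
Proof. by rewrite fejerE mulr_ge0 ?invr_ge0// addr_ge0// sqr_ge0. Qed.

Lemma fejer_leH H x : (0 < H)%N -> fejer H x <= H%:R.
Proof.
move=> H0; have H0' : 0 < H%:R :> R by rewrite ltr0n.
rewrite /fejer ler_pdivrMl//.
apply: (@le_trans _ _ (\sum_(h < H) \sum_(k < H) 1)).
  by apply: ler_sum => h _; apply: ler_sum => k _; exact: cos_le1.
by rewrite !sumr_const !card_ord -[X in X <= _]mulr_natl.
Qed.

(** Multiplying by the kernel amounts to averaging over integral translations
of the frequency; the sine terms cancel because h - k ranges symmetrically. *)
Lemma fejer_cos H x psi : fejer H x * cos psi =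
  H%:R^-1 * \sum_(h < H) \sum_(k < H) cos (psi + tau * ((h%:R - k%:R) * x)).
Proof.
rewrite /fejer -mulrA; congr (_ * _).
have -> : \sum_(h < H) \sum_(k < H) cos (psi + tau * ((h%:R - k%:R) * x)) =
    (\sum_(h < H) \sum_(k < H) cos (tau * ((h%:R - k%:R) * x))) * cos psi -
    (\sum_(h < H) \sum_(k < H) sin (tau * ((h%:R - k%:R) * x))) * sin psi.
  rewrite !mulr_suml -sumrB; apply: eq_bigr => h _.
  rewrite !mulr_suml -sumrB; apply: eq_bigr => k _.
  by rewrite cosD; ring.
have -> : \sum_(h < H) \sum_(k < H) sin (tau * ((h%:R - k%:R) * x)) = 0.
  set S := LHS; suff : S = - S by lra.
  rewrite /S -sumrN exchange_big /=; apply: eq_bigr => h _.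
  by rewrite -sumrN; apply: eq_bigr => k _; rewrite -sinN; congr sin; ring.
by rewrite mul0r subr0.
Qed.

(** Bounds the distance of x to the integers from below. *)
Definition far (eta x : R) := forall k : int, eta <= `|x - k%:~R|.

Lemma norm_sin_pi_int (x : R) (k : int) : `|sin (pi * (x + k%:~R))| = `|sin (pi * x)|.
Proof.
have natcase (y : R) (n : nat) : `|sin (pi * (y + n%:R))| = `|sin (pi * y)|.
  elim: n => [|n IH]; first by rewrite addr0.
  by rewrite -natr1 addrA mulrDr mulr1 (sinDpi (pi * (y + n%:R))) normrN.
case: (intP k) => [|n|n]; first by rewrite addr0.
  exact: natcase.
by rewrite mulrNz -[LHS](natcase _ n.+1) subrK.
Qed.

(** By periodicity and symmetry |sin (pi x)| depends only on the distance of x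
to the integers and increases with it. *)
Lemma far_sin (eta x : R) : 0 < eta -> eta <= 1 / 2 -> far eta x ->
  sin (pi * eta) <= `|sin (pi * x)|.
Proof.
move=> e0 e2 fx; have p0 := pi_gt0 R.
pose k := Num.floor x; pose y := x - k%:~R.
have /andP[kx xk] := floor_itv x.
have y1 : eta <= y by have := fx k; rewrite ger0_norm ?subr_ge0.
have y2 : y <= 1 - eta.
  have := fx (k + 1); rewrite ler0_norm ?subr_le0 ?(ltW xk)//.
  by rewrite /y intrD /=; lra.
rewrite -(subrK k%:~R x) -/y norm_sin_pi_int.
rewrite (le_trans _ (ler_norm _))//.
have -> : sin (pi * eta) = cos (pi * (1 / 2 - eta)).
  by rewrite -cosBpihalf -cosN; congr cos; field.
have -> : sin (pi * y) = cos `|pi * (y - 1 / 2)|.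
  by rewrite cos_norm -cosBpihalf; congr cos; field.
have b1 : `|pi * (y - 1 / 2)| <= pi * (1 / 2 - eta).
  rewrite normrM (gtr0_norm p0) ler_pM2l// ler_norml; apply/andP; split; lra.
have b2 : pi * (1 / 2 - eta) <= pi.
  by rewrite -[leRHS]mulr1 ler_pM2l//; lra.
rewrite le_eqVlt; move: b1; rewrite le_eqVlt => /orP[/eqP ->|b1].
  by rewrite eqxx.
have in1 : pi * (1 / 2 - eta) \in `[0, pi].
  by rewrite in_itv /= b2 mulr_ge0 ?(ltW p0)// subr_ge0.
have in2 : `|pi * (y - 1 / 2)| \in `[0, pi].
  by rewrite in_itv /= normr_ge0 (le_trans (ltW b1)).
by rewrite (ltr_cos in2 in1) b1 orbT.
Qed.

(** Away from the integers the geometric sums defining the kernel are bounded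
independently of H. *)
Lemma fejer_far (eta : R) : 0 < eta -> eta <= 1 / 2 ->
  exists2 K, 0 < K & forall H x, (0 < H)%N -> far eta x -> fejer H x <= K / H%:R.
Proof.
move=> e0 e2; have p0 := pi_gt0 R.
have s0 : 0 < sin (pi * eta).
  apply: sin_gt0_pi; rewrite mulr_gt0//=.
  by rewrite -[ltRHS]mulr1 ltr_pM2l//; lra.
exists (2 / sin (pi * eta) ^+ 2); first by rewrite divr_gt0// exprn_gt0.
move=> H x H0 fx; rewrite fejerE mulrC ler_wpM2r ?invr_ge0//.
have key phi : (\sum_(h < H) cos (h%:R * (tau * x) + phi)) ^+ 2 <=
    (sin (pi * eta) ^+ 2)^-1.
  have := cos_sum_bound (tau * x) phi H; set A := \sum_(_ < _) _.
  have -> : tau * x / 2 = pi * x by rewrite /tau; field.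
  have := far_sin e0 e2 fx; set s := sin _; set u := `|sin _| => su h.
  have : s * `|A| <= 1 by rewrite (le_trans _ h)// ler_wpM2r.
  move=> sA; rewrite -[leRHS]mul1r ler_pdivlMr ?exprn_gt0//.
  rewrite -(real_normK (num_real A)) -exprMn expr_le1// ?mulr_ge0 ?(ltW s0)//.
  by rewrite mulrC.
by have h1 := key 0; have h2 := key (- (pi / 2)); rewrite mulr_natl mulr2n lerD.
Qed.

Lemma cos_sum_period H (z : int) (psi : R) : (0 < H)%N -> z != 0 -> (`|z| < H)%N ->
  \sum_(r < H) cos (psi + tau * (z%:~R * (r%:R / H%:R))) = 0.
Proof.
move=> H0 z0 zH; have H0' : 0 < H%:R :> R by rewrite ltr0n.
have := cos_sum_telescope (tau * (z%:~R / H%:R)) psi H.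
have -> : H%:R * (tau * (z%:~R / H%:R)) + psi - tau * (z%:~R / H%:R) / 2 =
  (psi - tau * (z%:~R / H%:R) / 2) + tau * z%:~R by field; rewrite gt_eqF.
have -> (y : R) : sin (y + tau * z%:~R) = sin y by rewrite -!cosBpihalf addrAC cosDtau.
rewrite subrr => /eqP; rewrite mulf_eq0 => /orP[|/eqP h]; last first.
  by rewrite -[RHS]h; apply: eq_bigr => r _; congr cos; ring.
rewrite mulf_eq0 pnatr_eq0 /= => /eqP h; exfalso.
have : far H%:R^-1 (z%:~R / H%:R : R).
  move=> k; have -> : z%:~R / H%:R - k%:~R = (z - k * H%:Z)%:~R / H%:R :> R.
    by rewrite intrB intrM mulrBl mulfK// gt_eqF.
  rewrite normrM normfV (gtr0_norm H0') ler_peMl ?invr_ge0// -intr_norm ler1z.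
  rewrite -gtz0_ge1 normr_gt0 subr_eq0; apply/eqP => zk.
  move: zH; rewrite zk abszM /= -ltn_divRL// divnn H0 => /= .
  rewrite ltnS leqn0 absz_eq0 => /eqP k0; by rewrite zk k0 mul0r eqxx in z0.
have [H1|H1] := leqP H 1.
  by move: zH z0; rewrite (_ : H = 1%N) ?ltnS ?leqn0 ?absz_eq0; [move=> -> | lia].
have H2 : H%:R^-1 <= 1 / 2 :> R.
  by rewrite -[leRHS]mulr1 mul1r mulr1 lef_pV2 ?posrE// ler_nat.
move=> /(far_sin _ H2); rewrite invr_gt0 => /(_ H0').
have -> : pi * (z%:~R / H%:R) = tau * (z%:~R / H%:R) / 2 :> R by rewrite /tau; field; rewrite gt_eqF.
rewrite h normr0; apply/negP; rewrite -ltNge; apply: sin_gt0_pi.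
rewrite mulr_gt0 ?pi_gt0 ?invr_gt0//= -[ltRHS]mulr1 ltr_pM2l ?pi_gt0//.
by rewrite invf_lt1// ltr1n.
Qed.

(** Only the frequencies divisible by H survive the sum over r, and the kernel
has none but 0: the translates by r / H form a partition of unity up to the
factor H. *)
Lemma fejer_partition H x : (0 < H)%N ->
  \sum_(r < H) fejer H (x - r%:R / H%:R) = H%:R.
Proof.
move=> H0; have H0' : 0 < H%:R :> R by rewrite ltr0n.
rewrite -mulr_sumr exchange_big /=.
under eq_bigr do rewrite exchange_big /=.
have key (h k : 'I_H) : \sum_(r < H) cos (tau * ((h%:R - k%:R) * (x - r%:R / H%:R))) =
    if h == k then H%:R else 0.
  case: eqP => [->|hk].
    under eq_bigr do rewrite subrr mul0r mulr0 cos0.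
    by rewrite sumr_const card_ord.
  rewrite -[RHS](@cos_sum_period H (k%:Z - h%:Z) (tau * ((h%:R - k%:R) * x)) H0).
  - by apply: eq_bigr => r _; congr cos; rewrite intrB; ring.
  - by rewrite subr_eq0; apply/eqP => -[] e; apply: hk; exact: val_inj.
  - by have := ltn_ord h; have := ltn_ord k; lia.
under eq_bigr => h _.
  under eq_bigr => k _ do rewrite key.
  rewrite -big_mkcond /= (eq_bigl (pred1 h)); last by move=> k /=; rewrite eq_sym.
  rewrite big_pred1_eq; over.
by rewrite sumr_const card_ord -[X in _ * X]mulr_natl mulrA mulVf ?mul1r// gt_eqF.
Qed.

End Fejer.

(** * Averages over several scales *)

Section Multiscale.
Variable R : realType.

Definition zero_at (k : nat) (b : nat -> R) : nat -> R :=
  fun j => if j == k then 0 else b j.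

(** For r = 1 these lists encode convex combinations over scales N; other
values of r let lists be concatenated before normalisation. *)
Definition wlist (r : R) (N0 : nat) (Q : seq (R * nat)) :=
  (forall q, q \in Q -> 0 <= q.1 /\ (N0 <= q.2)%N) /\ \sum_(q <- Q) q.1 = r.

Lemma wlist_lower (r x : R) N0 Q (f : nat -> R) : wlist r N0 Q ->
  (forall N, (N0 <= N)%N -> x <= f N) -> r * x <= \sum_(q <- Q) q.1 * f q.2.
Proof.
move=> [Q0 <-] hx; rewrite mulr_suml big_seq_cond [leRHS]big_seq_cond.
apply: ler_sum => q; rewrite andbT => /Q0[q0 qN].
by rewrite ler_wpM2l// hx.
Qed.

Lemma wlist_cat (r r' : R) N0 N0' Q Q' : (N0 <= N0')%N -> wlist r N0 Q -> wlist r' N0' Q' ->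
  wlist (r + r') N0 (Q ++ Q').
Proof.
move=> NN [hQ sQ] [hQ' sQ']; split; last by rewrite big_cat sQ sQ'.
move=> q; rewrite mem_cat => /orP[/hQ//|/hQ'[h1 h2]]; split => //.
exact: leq_trans h2.
Qed.

Variables (T : Type) (V : nat -> T -> (nat -> R) -> R) (ok : T -> Prop).
Variables (okb : (nat -> R) -> Prop) (d M : nat) (e1 : R).
Hypothesis e1_ge0 : 0 <= e1.
Hypothesis okb0 : forall k b, okb b -> okb (zero_at k b).
Hypothesis lipV : forall N k, exists K, forall t b, ok t ->
  `|V N t b - V N t (zero_at k b)| <= K * `|b k|.
Hypothesis geV : forall N t b, (M <= N)%N -> ok t -> -2 <= V N t b.
Hypothesis smallV : forall k delta, (k <= d)%N -> 0 < delta ->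
  exists N1, forall N t b, (N1 <= N)%N -> ok t -> okb b ->
    (forall j, (j < k)%N -> b j = 0) -> delta <= `|b k| -> - e1 <= V N t b.
Hypothesis zeroV : forall N t b, (M <= N)%N -> ok t ->
  (forall j, (j <= d)%N -> b j = 0) -> - e1 <= V N t b.

Let val Q t b := \sum_(q <- Q) q.1 * V q.2 t b.

Lemma val_lip Q k : exists K, 0 < K /\ forall t b, ok t ->
  `|val Q t b - val Q t (zero_at k b)| <= K * `|b k|.
Proof.
elim: Q => [|q Q [K [K0 hK]]].
  by exists 1; split => // t b _; rewrite /val !big_nil subrr normr0 mul1r.
have [K' hK'] := lipV q.2 k.
exists (`|q.1| * `|K'| + K); split; first by rewrite ltr_wpDl// mulr_ge0.
move=> t b tok; rewrite /val !big_cons opprD addrACA -mulrBr.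
rewrite (le_trans (ler_normD _ _))// mulrDl lerD//; last exact: hK.
rewrite normrM -mulrA ler_wpM2l// (le_trans (hK' _ _ tok))// ler_wpM2r//.
exact: ler_norm.
Qed.

Let claim k := forall rho N0, 0 < rho -> exists2 Q, wlist 1 N0 Q &
  forall t b, ok t -> okb b -> (forall j, (j < k)%N -> b j = 0) ->
    - (e1 + rho) <= val Q t b.

(** Passing from vanishing of the coordinates 0, ..., k to vanishing of the
coordinates before k. Take r successive lists, each obtained for k + 1, the
scales of the next one being large in terms of the previous one. By
continuity a list is harmless for b k small, and by [smallV] for b k not too
small; a given b lies in the intermediate range of at most one list, which
costs a bounded amount. Dividing by r makes this cost negligible. *)
Lemma claim_step k : (k <= d)%N -> claim k.+1 -> claim k.
Proof.
move=> kd IH rho N0 rho0.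
pose rho2 := rho / 2; have rho20 : 0 < rho2 by rewrite divr_gt0.
have rho40 : 0 < rho2 / 2 by rewrite divr_gt0.
(* lists of total weight r: the loss exceeds r (e1 + rho / 2) by at most 2 *)
have U (r : nat) : forall N0, exists2 Q, wlist r%:R N0 Q &
    forall t b, ok t -> okb b -> (forall j, (j < k)%N -> b j = 0) ->
      r%:R * - (e1 + rho2) - 2 <= val Q t b.
  elim: r => [|r IHr] {}N0.
    exists [::]; first by split; rewrite ?big_nil.
    by move=> t b _ _ _; rewrite /val big_nil mul0r sub0r oppr_le0.
  have [Q0 wQ0 hQ0] := IH _ (maxn M N0) rho40.
  have [K [K0 hK]] := val_lip Q0 k.
  have del0 : 0 < rho2 / 2 / K by rewrite divr_gt0.
  have [N1 hN1] := smallV kd del0.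
  have [Q' wQ' hQ'] := IHr (maxn N1 (maxn M N0)).
  exists (Q0 ++ Q').
    rewrite -natr1 addrC; apply: (@wlist_cat _ _ _ (maxn N1 (maxn M N0))).
    - by rewrite !leq_max leqnn !orbT.
    - split; last by case: wQ0.
      move=> q /wQ0.1[h1]; rewrite geq_max => /andP[_ h2]; by split.
    - by [].
  move=> t b tok bok bk.
  rewrite /val big_cat /= -/(val Q0 t b) -/(val Q' t b) -natr1 mulrDl mul1r.
  (* either the first list is harmless by continuity, or all the later ones
     are small *)
  have [hb|hb] := ltP `|b k| (rho2 / 2 / K).
    rewrite -addrA addrCA lerD//; last exact: hQ'.
    have := hK t b tok; rewrite ler_norml => /andP[h _].
    have hz : - (e1 + rho2 / 2) <= val Q0 t (zero_at k b).
      apply: hQ0 => //; first exact: okb0.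
      move=> j; rewrite ltnS leq_eqVlt /zero_at => /orP[/eqP ->|jk]; first by rewrite eqxx.
      by rewrite ltn_eqF// bk.
    have : K * `|b k| <= rho2 / 2 by rewrite mulrC -ler_pdivlMr// ltW.
    move: h hz; lra.
  have h0 : 1 * -2 <= val Q0 t b.
    apply: (@wlist_lower _ _ _ _ (fun N => V N t b) wQ0) => N; rewrite geq_max => /andP[MN _]; exact: geV.
  have h1 : r%:R * - e1 <= val Q' t b.
    apply: (@wlist_lower _ _ _ _ (fun N => V N t b) wQ') => N; rewrite geq_max => /andP[MN _]; exact: hN1 hb.
  have h2 : r%:R * rho2 >= 0 by rewrite mulr_ge0// ltW.
  move: h0 h1 h2 e1_ge0 rho20; lra.
pose r := (Num.truncn (2 / rho2)).+1.
have r0 : 0 < r%:R :> R by rewrite ltr0n.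
have hr : 2 < r%:R * rho2 by rewrite -ltr_pdivrMr//; exact: truncnS_gt.
have [Q [Q1 Q2] hQ] := U r N0.
exists [seq (q.1 / r%:R, q.2) | q <- Q].
  split; last by rewrite big_map /= -mulr_suml Q2 divff// gt_eqF.
  move=> _ /mapP[q /Q1[h1 h2] ->] /=; split => //; by rewrite divr_ge0// ltW.
move=> t b tok bok bk.
have -> : val [seq (q.1 / r%:R, q.2) | q <- Q] t b = val Q t b / r%:R.
  rewrite /val big_map /= mulr_suml; apply: eq_bigr => q _; by rewrite mulrAC.
rewrite ler_pdivlMr// (le_trans _ (hQ t b tok bok bk))//.
move: hr; rewrite (_ : rho = rho2 + rho2); last by rewrite -splitr.
nra.
Qed.

(** V N t b stands for an average up to N of cosines with frequency vector b.
It is at least -e1 if b = 0, or if the first nonzero coordinate of b is bounded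
below and N is large. No single N serves all b, but a weighted average over
several scales does. *)
Lemma multiscale rho N0 : 0 < rho -> exists2 Q, wlist 1 N0 Q &
  forall t b, ok t -> okb b -> - (e1 + rho) <= \sum_(q <- Q) q.1 * V q.2 t b.
Proof.
have c0 : claim 0.
  have : forall m, (m <= d.+1)%N -> claim (d.+1 - m).
    elim => [|m IH] md.
      rewrite subn0 => rho' N0' rho0; exists [:: (1, maxn N0' M)].
        split; last by rewrite big_seq1.
        by move=> q; rewrite inE => /eqP -> /=; rewrite leq_maxl.
      move=> t b tok bok b0; rewrite /val big_seq1 mul1r.
      rewrite (@le_trans _ _ (- e1))//; first by rewrite lerN2 lerDl ltW.
      apply: zeroV => //; first exact: leq_maxr.
    apply: claim_step; first by rewrite subSS leq_subr.
    by have := IH (ltnW md); rewrite subSS subSn.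
  by move=> /(_ d.+1 (leqnn _)); rewrite subnn.
move=> rho0; have [Q wQ hQ] := c0 rho N0 rho0.
by exists Q => // t b tok bok; apply: hQ.
Qed.

End Multiscale.

(** * Fejer weights *)

Section Weights.
Variable R : realType.
Local Notation tau := (tau R).
Variables (a : nat -> nat -> R) (d : nat).

(** The uniform cancellation of cosine sums, the only property of the
sequences a i that the equidistribution argument uses. *)
Definition weyl_family := forall delta C e : R, 0 < delta -> 0 < e ->
  exists N1, forall N i g phi, (N1 <= N)%N -> (i <= d)%N -> leading i delta C g ->
    `|\sum_(n < N) cos (phi + \sum_(j < d.+1) g j * a j n)| <= e * N%:R.

Hypothesis Hweyl : weyl_family.

Definition linear_phase (g t : nat -> R) n := tau * \sum_(j < d.+1) g j * (a j n - t j).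

(** Concentrates the points (a i n) with i in s near the target t modulo 1,
while remaining a trigonometric polynomial. *)
Definition weight H (s : seq nat) (t : nat -> R) n :=
  \prod_(i <- s) fejer H (a i n - t i).

Definition shift_at (g : nat -> R) i z : nat -> R := fun j => if j == i then g j + z else g j.

Lemma weight_ge0 H s t n : 0 <= weight H s t n.
Proof. by apply: prodr_ge0 => i _; exact: fejer_ge0. Qed.

Lemma weight_cons H i s t n :
  weight H (i :: s) t n = fejer H (a i n - t i) * weight H s t n.
Proof. by rewrite /weight big_cons. Qed.

Lemma weight_le H s t n : (0 < H)%N -> weight H s t n <= H%:R ^+ size s.
Proof.
move=> H0; elim: s => [|i s IH]; first by rewrite /weight big_nil.
rewrite weight_cons exprS ler_pM//; [exact: fejer_ge0|exact: weight_ge0|exact: fejer_leH].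
Qed.

Lemma linear_phase_shift g t n i z : (i <= d)%N ->
  linear_phase (shift_at g i z) t n = linear_phase g t n + tau * (z * (a i n - t i)).
Proof.
move=> id; rewrite /linear_phase -mulrDr; congr (_ * _).
rewrite (bigD1 (Ordinal (id : (i < d.+1)%N)))//= [in RHS](bigD1 (Ordinal (id : (i < d.+1)%N)))//=.
rewrite [in LHS]/shift_at eqxx mulrDl addrAC; congr (_ + _ + _).
apply: eq_bigr => j ji; rewrite /shift_at ifF//.
by apply/negP => /eqP ej; move/eqP: ji; apply; exact: val_inj.
Qed.

Lemma linear_phase_shift0 t n i z : (i <= d)%N ->
  linear_phase (shift_at (fun=> 0) i z) t n = tau * (z * (a i n - t i)).
Proof.
move=> id; rewrite linear_phase_shift// [X in X + _]/linear_phase big1 ?mulr0 ?add0r// => j _.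
by rewrite mul0r.
Qed.

(** The frequency vectors that arise from g when the weight is expanded:
translations of g by integral vectors supported on s. *)
Definition near_int (s : seq nat) (H : nat) (g g' : nat -> R) :=
  forall j, (j \notin s -> g' j = g j) /\
    exists2 z : int, g' j = g j + z%:~R & `|z%:~R| <= (H * size s)%:R :> R.

(** Each of the size s kernels contributes H^2 translated frequencies with
coefficient 1 / H. *)
Lemma expand_weight H s t N B g : (0 < H)%N -> all (fun i => i <= d)%N s ->
  (forall g', near_int s H g g' -> `|\sum_(n < N) cos (linear_phase g' t n)| <= B) ->
  `|\sum_(n < N) weight H s t n * cos (linear_phase g t n)| <= H%:R ^+ size s * B.
Proof.
move=> H0; have H0' : 0 < H%:R :> R by rewrite ltr0n.
elim: s g => [|i s IH] g /=.
  move=> _ /(_ g) h; rewrite expr0 mul1r.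
  under eq_bigr do rewrite /weight big_nil mul1r.
  apply: h => j; split => //; exists 0; rewrite ?addr0// normr0//.
move=> /andP[id sd] hB.
have -> : \sum_(n < N) weight H (i :: s) t n * cos (linear_phase g t n) =
   H%:R^-1 * \sum_(h < H) \sum_(k < H) \sum_(n < N) weight H s t n * cos (linear_phase (shift_at g i (h%:R - k%:R)) t n).
  transitivity (\sum_(n < N) H%:R^-1 * \sum_(h < H) \sum_(k < H) weight H s t n * cos (linear_phase (shift_at g i (h%:R - k%:R)) t n)).
    apply: eq_bigr => n _; rewrite weight_cons mulrAC fejer_cos -mulrA; congr (_ * _).
    rewrite mulr_suml; apply: eq_bigr => h _; rewrite mulr_suml; apply: eq_bigr => k _.
    by rewrite linear_phase_shift// mulrC.
  rewrite -mulr_sumr exchange_big /=; congr (_ * _).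
  by apply: eq_bigr => h _; rewrite exchange_big.
rewrite normrM normfV (gtr0_norm H0') ler_pdivrMl// (le_trans (ler_norm_sum _ _ _))//.
apply: (@le_trans _ _ (\sum_(h < H) \sum_(k < H) (H%:R ^+ size s * B))); last first.
  by rewrite !sumr_const !card_ord -[X in X <= _]mulr_natl -[X in _ * X <= _]mulr_natl exprS !mulrA.
apply: ler_sum => h _; rewrite (le_trans (ler_norm_sum _ _ _))//.
apply: ler_sum => k _; apply: IH => // g' hg'; apply: hB => j.
have [h1 [z h2 h3]] := hg' j; split.
  rewrite inE negb_or => /andP[ji js]; by rewrite h1// /shift_at (negbTE ji).
rewrite /shift_at in h2; case: eqP h2 => [ji|_] h2; last first.
  exists z => //; rewrite (le_trans h3)// ler_nat leq_mul2l; apply/orP; right; exact: leqnSn.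
exists (h%:Z - k%:Z + z).
  by rewrite h2 intrD intrB -[LHS]addrA.
rewrite intrD (le_trans (ler_normD _ _))// mulnS natrD lerD//.
rewrite intrB ler_norml; apply/andP; split.
  by rewrite lerNl opprB lerBlDr (le_trans (_ : _ <= H%:R))// ?lerDl// ler_nat ltnW.
by rewrite lerBlDr (le_trans (_ : _ <= H%:R))// ?lerDl// ler_nat ltnW.
Qed.

(** A nonzero integer has absolute value at least 1, so the first nonzero
coordinate is bounded below whether it precedes i or not. *)
Lemma int_leading (g : nat -> R) i delta C : 0 < delta -> delta <= 1 ->
  (forall j, (j < i)%N -> exists z : int, g j = z%:~R) -> delta <= `|g i| ->
  (forall j, `|g j| <= C) ->
  exists2 i', (i' <= i)%N & leading i' delta C g.
Proof.
move=> d0 d1 gz gi gC.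
have ex : exists j, g j != 0.
  by exists i; rewrite -normr_gt0 (lt_le_trans d0).
case: (ex_minnP ex) => m gm mmin; exists m.
  by apply: mmin; rewrite -normr_gt0 (lt_le_trans d0).
split => //.
  by move=> j jm; apply/eqP; apply: contraTT jm => /mmin; rewrite -leqNgt.
have [mi|im] := ltnP m i; last first.
  have -> // : m = i by apply/eqP; rewrite eqn_leq im mmin// -normr_gt0 (lt_le_trans d0).
have [z gmz] := gz m mi; rewrite gmz (le_trans d1)// -intr_norm ler1z -gtz0_ge1 normr_gt0.
by apply: contra gm => /eqP z0; rewrite gmz z0.
Qed.

Lemma cos_linear_phase_small (delta C e : R) : 0 < delta -> delta <= 1 -> 0 < e ->
  exists N1, forall N i g t, (N1 <= N)%N -> (i <= d)%N ->
  (forall j, (j < i)%N -> exists z : int, g j = z%:~R) -> delta <= `|g i| ->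
  (forall j, `|g j| <= C) ->
  `|\sum_(n < N) cos (linear_phase g t n)| <= e * N%:R.
Proof.
move=> d0 d1 e0; have t0 := tau_gt0 R.
have [N1 hN1] := Hweyl (tau * C) (mulr_gt0 t0 d0) e0.
exists N1 => N i g t NN id gz gi gC.
have [i' i'i [l1 l2 l3]] := int_leading d0 d1 gz gi gC.
have := hN1 N i' (fun j => tau * g j) (- (tau * \sum_(j < d.+1) g j * t j)) NN (leq_trans i'i id).
have -> : \sum_(n < N) cos (- (tau * \sum_(j < d.+1) g j * t j) + \sum_(j < d.+1) tau * g j * a j n) =
   \sum_(n < N) cos (linear_phase g t n).
  apply: eq_bigr => n _; congr cos; rewrite /linear_phase addrC.
  under eq_bigr do rewrite -mulrA.
  rewrite -mulr_sumr -mulrBr -sumrB; congr (_ * _); apply: eq_bigr => j _; by rewrite mulrBr.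
apply; split => [j jm||j].
- by rewrite l1// mulr0.
- by rewrite normrM (gtr0_norm t0) ler_pM2l.
- by rewrite normrM (gtr0_norm t0) ler_pM2l.
Qed.

Lemma near_int_bound s H g g' C : near_int s H g g' -> (forall j, `|g j| <= C) ->
  forall j, `|g' j| <= C + (H * size s)%:R.
Proof.
move=> hn gC j; have [_ [z -> hz]] := hn j.
by rewrite (le_trans (ler_normD _ _))// lerD.
Qed.

(** Integral translations of a vector with coordinates in [-1/2, 1/2] keep the
first nonzero coordinate bounded away from 0. *)
Lemma weighted_small H s (delta e : R) : (0 < H)%N -> all (fun i => i <= d)%N s ->
  0 < delta -> delta <= 1 / 2 -> 0 < e ->
  exists N1, forall N i g t, (N1 <= N)%N -> (i <= d)%N ->
    (forall j, (j < i)%N -> g j = 0) -> delta <= `|g i| ->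
    (forall j, `|g j| <= 1 / 2) ->
    `|\sum_(n < N) weight H s t n * cos (linear_phase g t n)| <= e * N%:R.
Proof.
move=> H0 sd d0 d2 e0.
have X0 : 0 < H%:R ^+ size s :> R by rewrite exprn_gt0// ltr0n.
have d1 : delta <= 1 by rewrite (le_trans d2)// ler_pdivrMr// mul1r ler1n.
have [N1 hN1] := @cos_linear_phase_small delta (1 / 2 + (H * size s)%:R) (e / H%:R ^+ size s)
   d0 d1 (divr_gt0 e0 X0).
exists N1 => N i g t NN id gz gi gC.
have -> : e * N%:R = H%:R ^+ size s * (e / H%:R ^+ size s * N%:R) by field; rewrite gt_eqF.
apply: expand_weight => // g' hg'; apply: (hN1 N i) => //.
- move=> j ji; have [_ [z -> _]] := hg' j; exists z; by rewrite gz// add0r.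
- have [_ [z zE _]] := hg' i.
  have [z0|z0] := eqVneq z 0; first by rewrite zE z0 addr0.
  have : (1 : R) <= `|z%:~R| by rewrite -intr_norm ler1z -gtz0_ge1 normr_gt0.
  have := lerB_normD z%:~R (g i); rewrite [_ + g i]addrC -zE; have := gC i.
  move: d2; lra.
- exact: near_int_bound.
Qed.

(** Among the frequencies of the weight, only the zero frequency contributes
to the mean. One kernel is split off at a time: its H diagonal terms reproduce
the weight of the others, the remaining ones have a nonzero integral
frequency. *)
Lemma weight_mean H s (e : R) : (0 < H)%N -> all (fun i => i <= d)%N s -> uniq s ->
  0 < e -> exists N1, forall N t, (N1 <= N)%N ->
    `|\sum_(n < N) weight H s t n - N%:R| <= e * N%:R.
Proof.
move=> H0; have H0' : 0 < H%:R :> R by rewrite ltr0n.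
elim: s e => [|i s IH] e /=.
  move=> _ _ e0; exists 0%N => N t _.
  under eq_bigr do rewrite /weight big_nil.
  by rewrite sumr_const card_ord subrr normr0 mulr_ge0// ltW.
move=> /andP[id sd] /andP[isN us] e0.
have e2 : 0 < e / 2 by rewrite divr_gt0.
have [N1 hN1] := IH (e / 2) sd us e2.
have X0 : 0 < H%:R ^+ size s * H%:R :> R by rewrite mulr_gt0// exprn_gt0.
have [N2 hN2] := @cos_linear_phase_small 1 (H%:R + (H * size s)%:R)
   (e / 2 / (H%:R ^+ size s * H%:R)) ltr01 (lexx 1) (divr_gt0 e2 X0).
exists (maxn N1 N2) => N t; rewrite geq_max => /andP[NN1 NN2].
pose A := \sum_(n < N) weight H s t n.
have key (h k : 'I_H) : `|\sum_(n < N) weight H s t n *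
     cos (linear_phase (shift_at (fun=> 0) i (h%:R - k%:R)) t n) - (if h == k then A else 0)|
     <= e / 2 / H%:R * N%:R.
  case: eqP => [->|hk].
    under eq_bigr do rewrite linear_phase_shift0// subrr mul0r mulr0 cos0 mulr1.
    by rewrite subrr normr0 mulr_ge0// divr_ge0// ltW.
  have -> : e / 2 / H%:R * N%:R = H%:R ^+ size s * (e / 2 / (H%:R ^+ size s * H%:R) * N%:R).
    by field; rewrite gt_eqF// expf_neq0// gt_eqF.
  rewrite subr0; apply: expand_weight => // g' hg'; apply: (hN2 N i) => //.
  - move=> j ji; have [_ [z -> _]] := hg' j; exists z; by rewrite /shift_at ltn_eqF// add0r.
  - have [gi _] := hg' i; rewrite gi// /shift_at eqxx add0r.
    have -> : h%:R - k%:R = (h%:Z - k%:Z)%:~R :> R by rewrite intrB.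
    rewrite -intr_norm ler1z -gtz0_ge1 normr_gt0 subr_eq0; apply/eqP => -[] ehk.
    by apply: hk; exact: val_inj.
  - move=> j; apply: (near_int_bound hg') => {}j; rewrite /shift_at; case: eqP => _; last by rewrite normr0.
    rewrite add0r ler_norml; apply/andP; split.
      by rewrite lerNl opprB lerBlDr (le_trans (_ : _ <= H%:R))// ?lerDl// ler_nat ltnW.
    by rewrite lerBlDr (le_trans (_ : _ <= H%:R))// ?lerDl// ler_nat ltnW.
have -> : \sum_(n < N) weight H (i :: s) t n - N%:R =
   H%:R^-1 * (\sum_(h < H) \sum_(k < H) (\sum_(n < N) weight H s t n *
     cos (linear_phase (shift_at (fun=> 0) i (h%:R - k%:R)) t n) - (if h == k then A else 0)))
    + (A - N%:R).
  rewrite addrA; congr (_ - _).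
  have -> : \sum_(h < H) \sum_(k < H) (\sum_(n < N) weight H s t n *
     cos (linear_phase (shift_at (fun=> 0) i (h%:R - k%:R)) t n) - (if h == k then A else 0)) =
    \sum_(h < H) \sum_(k < H) (\sum_(n < N) weight H s t n *
     cos (linear_phase (shift_at (fun=> 0) i (h%:R - k%:R)) t n)) - H%:R * A.
    under eq_bigr do rewrite sumrB.
    rewrite sumrB; congr (_ - _).
    transitivity (\sum_(h < H) A); last by rewrite sumr_const card_ord mulr_natl.
    apply: eq_bigr => h _.
    by rewrite -big_mkcond /=; apply: big_pred1 => k; exact: eq_sym.
  rewrite mulrBr mulrA mulVf ?gt_eqF// mul1r subrK.
  transitivity (\sum_(n < N) H%:R^-1 * \sum_(h < H) \sum_(k < H) weight H s t n * cos (linear_phase (shift_at (fun=> 0) i (h%:R - k%:R)) t n)).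
    apply: eq_bigr => n _; rewrite weight_cons /fejer -mulrA; congr (_ * _).
    rewrite mulr_suml; apply: eq_bigr => h _; rewrite mulr_suml; apply: eq_bigr => k _.
    by rewrite linear_phase_shift0// mulrC.
  rewrite -mulr_sumr exchange_big /=; congr (_ * _).
  by apply: eq_bigr => h _; rewrite exchange_big.
rewrite (le_trans (ler_normD _ _))// (splitr e) mulrDl lerD//; last exact: hN1.
rewrite normrM normfV (gtr0_norm H0') ler_pdivrMl// (le_trans (ler_norm_sum _ _ _))//.
apply: (@le_trans _ _ (\sum_(h < H) \sum_(k < H) (e / 2 / H%:R * N%:R))).
  apply: ler_sum => h _; rewrite (le_trans (ler_norm_sum _ _ _))//.
  by apply: ler_sum => k _; exact: key.
rewrite !sumr_const !card_ord -[X in X <= _]mulr_natl -[X in _ * X <= _]mulr_natl.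
by rewrite le_eqVlt; apply/orP; left; apply/eqP; field; rewrite gt_eqF.
Qed.

End Weights.

(** * Averages of characters of integral parts *)

Section Core.
Variable R : realType.
Local Notation tau := (tau R).
Variables (a : nat -> nat -> R) (d : nat).
Hypothesis Hweyl : weyl_family a d.

(** Some fractional part is not within eta of its target, so the weight is
small there and the integral parts are not controlled. *)
Definition off_target eta (s : seq nat) (t : nat -> R) n : bool :=
  `[< exists2 i, i \in s & far eta (a i n - t i) >].

Definition floor_phase (b : nat -> R) n : R :=
  tau * \sum_(j < d.+1) b j * (Num.floor (a j n))%:~R.

Lemma off_target_le eta eta' s t n : eta <= eta' -> (off_target eta' s t n <= off_target eta s t n)%N.
Proof.
move=> ee; case: (asboolP (exists2 i, i \in s & far eta' (a i n - t i))) => h.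
  rewrite /off_target (asboolT h) asboolT//; have [i si fi] := h.
  by exists i => // k; rewrite (le_trans ee).
by rewrite /off_target (asboolF h).
Qed.

(** Away from the target one of the kernels is O(1/H), whereas the product of
the others has mean close to 1. *)
Lemma weight_off_target (eta e : R) s H1 : 0 < eta -> eta <= 1 / 2 -> 0 < e ->
  all (fun i => i <= d)%N s -> uniq s ->
  exists2 H, (0 < H)%N && (H1 <= H)%N & exists N1, forall N t, (N1 <= N)%N ->
    \sum_(n < N) weight a H s t n * (off_target eta s t n)%:R <= e * N%:R.
Proof.
move=> eta0 eta2 e0 sd us.
have [K K0 hK] := fejer_far eta0 eta2.
pose H := (maxn H1 (Num.truncn (2 * K * (size s)%:R / e))).+1.
have H0 : 0 < H%:R :> R by rewrite ltr0n.
have He : 2 * K * (size s)%:R <= H%:R * e.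
  rewrite -ler_pdivrMr// ltW// (lt_le_trans (truncnS_gt _))// ler_nat ltnS.
  exact: leq_maxr.
exists H; first by rewrite /= ltnW// ltnS leq_maxl.
have [i|N1 hN1] := @common_threshold _ s (fun i N => forall t,
    `|\sum_(n < N) weight a H (rem i s) t n - N%:R| <= 1 * N%:R).
  move=> si; have sd' : all (fun i => i <= d)%N (rem i s).
    by apply/allP => j /mem_rem; exact: (allP sd).
  have [N hN] := weight_mean Hweyl (isT : (0 < H)%N) sd' (rem_uniq i us) ltr01.
  by exists N => m Nm t; apply: hN.
exists N1 => N t NN.
apply: (@le_trans _ _ (\sum_(n < N) \sum_(i <- s) K / H%:R * weight a H (rem i s) t n)).
  apply: ler_sum => n _.
  have [b|nb] := boolP (off_target eta s t n); last first.
    by rewrite mulr0 sumr_ge0// => i _; rewrite mulr_ge0 ?weight_ge0// divr_ge0// ltW.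
  rewrite mulr1; move/asboolP: b => [i si fi].
  rewrite (big_rem i)//= -[leLHS]addr0 lerD//; last first.
    by rewrite sumr_ge0// => j _; rewrite mulr_ge0 ?weight_ge0// divr_ge0// ltW.
  have -> : weight a H s t n = weight a H (i :: rem i s) t n.
    by apply: perm_big; exact: perm_to_rem.
  by rewrite weight_cons ler_wpM2r ?weight_ge0// hK.
rewrite exchange_big /= big_seq_cond.
apply: (@le_trans _ _ (\sum_(i <- s | (i \in s) && true) (K / H%:R * (2 * N%:R)))).
  apply: ler_sum => i; rewrite andbT => si; rewrite -mulr_sumr ler_wpM2l ?divr_ge0 ?(ltW K0)//.
  have := hN1 i N si NN t; rewrite mul1r ler_norml => /andP[_]; lra.
rewrite -big_seq_cond big_const_seq count_predT iter_addr_0 -[X in X <= _]mulr_natl.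
have -> : (size s)%:R * (K / H%:R * (2 * N%:R)) = (2 * K * (size s)%:R / H%:R) * N%:R.
  by field; rewrite gt_eqF.
by rewrite ler_wpM2r// ler_pdivrMr// [e * _]mulrC.
Qed.

Lemma floor_close (eta x t : R) : 0 < eta -> eta <= t -> t <= 1 - eta -> ~ far eta (x - t) ->
  `|x - t - (Num.floor x)%:~R| < eta.
Proof.
move=> eta0 te et nf.
have [k hk] : exists k : int, `|x - t - k%:~R| < eta.
  apply: contrapT => h; apply: nf => k; rewrite leNgt; apply/negP => hk; apply: h.
  by exists k.
have -> // : Num.floor x = k.
apply: floor_def; rewrite intrD /=; move: hk; rewrite ltr_norml => /andP[h1 h2].
by apply/andP; split; move: h1 h2 te et; lra.
Qed.

(** Near the target the integral part of a j n is a j n - t j up to eta, so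
the character of integral parts is almost a character of the a j n. *)
Lemma floor_phase_close eta s t b n : 0 < eta -> (forall j, j \in s -> eta <= t j <= 1 - eta) ->
  (forall j, j \notin s -> b j = 0) -> (forall j, `|b j| <= 1 / 2) ->
  `|cos (floor_phase b n) - cos (linear_phase a d b t n)| <=
    tau * d.+1%:R * eta + 2 * (off_target eta s t n)%:R.
Proof.
move=> eta0 ht bs b2; have t0 := tau_gt0 R.
have [bn|/asboolPn nb] := boolP (off_target eta s t n).
  rewrite mulr1 (le_trans (ler_normB _ _))// (@le_trans _ _ 2)//.
    by have := cos_max (floor_phase b n); have := cos_max (linear_phase a d b t n); lra.
  by rewrite lerDr; apply: mulr_ge0; [apply: mulr_ge0 => //|]; exact: ltW.
rewrite mulr0 addr0 (le_trans (cos_lip _ _))//.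
rewrite /floor_phase /linear_phase -mulrBr normrM (gtr0_norm t0) -mulrA ler_wpM2l ?(ltW t0)//.
rewrite -sumrB (le_trans (ler_norm_sum _ _ _))//.
apply: (@le_trans _ _ (\sum_(j < d.+1) eta)); last by rewrite sumr_const card_ord -[X in X <= _]mulr_natl.
apply: ler_sum => j _; rewrite -mulrBr normrM.
have [js|js] := boolP ((j : nat) \in s); last by rewrite bs// normr0 mul0r ltW.
have nf : ~ far eta (a j n - t j) by move=> f; apply: nb; exists (j : nat).
have /andP[t1 t2] := ht j js.
have := floor_close eta0 t1 t2 nf; rewrite distrC => h.
rewrite -[leRHS]mul1r ler_pM// ?(ltW h)//.
by rewrite (le_trans (b2 j))// ler_pdivrMr// mul1r ler1n.
Qed.

(** Only the frequencies modulo 1 matter, since the integral parts are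
integers. *)
Lemma floor_phase_reduce b : exists b', [/\ forall j, `|b' j| <= 1 / 2,
  forall j, b j = 0 -> b' j = 0 & forall n, cos (floor_phase b' n) = cos (floor_phase b n)].
Proof.
(* the nearest integer *)
pose z j := Num.floor (b j + 1 / 2).
exists (fun j => b j - (z j)%:~R); split.
- move=> j; have /andP[] := floor_itv (b j + 1 / 2); rewrite -/(z j) intrD /= ler_norml.
  by move=> h1 h2; apply/andP; split; move: h1 h2; lra.
- move=> j bj; rewrite bj sub0r /z bj add0r (_ : Num.floor _ = 0) ?oppr0//.
  by apply: floor_def; rewrite add0r /=; apply/andP; split; lra.
- move=> n; rewrite -[RHS](cosDtau _ (- \sum_(j < d.+1) z j * Num.floor (a j n))).
  congr cos; rewrite /floor_phase -mulrDr; congr (_ * _).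
  rewrite rmorphN rmorph_sum /= -sumrB; apply: eq_bigr => j _.
  by rewrite mulrBl rmorphM.
Qed.

(** The hypotheses of [multiscale] hold for the weighted averages of
cos (floor_phase b n): they are within a small error of averages of
cos (linear_phase b t n), which are small by [weighted_small] when the first
nonzero coordinate of b is bounded below. *)
Lemma weight_core (s : seq nat) (eta0 e : R) H1 : all (fun i => i <= d)%N s -> uniq s ->
  0 < eta0 -> eta0 <= 1 / 2 -> 0 < e ->
  exists2 H, (0 < H)%N && (H1 <= H)%N & forall N0, exists2 Q, wlist 1 N0 Q &
    (forall q t, q \in Q -> [/\ (0 < q.2)%N,
        `|\sum_(n < q.2) weight a H s t n - q.2%:R| <= e * q.2%:R &
        \sum_(n < q.2) weight a H s t n * (off_target eta0 s t n)%:R <= e * q.2%:R]) /\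
    (forall t b, (forall j, j \in s -> eta0 <= t j <= 1 - eta0) ->
       (forall j, j \notin s -> b j = 0) ->
       - e <= \sum_(q <- Q) q.1 *
          ((\sum_(n < q.2) weight a H s t n * cos (floor_phase b n)) / q.2%:R)).
Proof.
move=> sd us eta00 eta02 e0; have t0 := tau_gt0 R.
pose e' := e / 8; have e'0 : 0 < e' by rewrite divr_gt0.
have e'e : e' <= e by rewrite ler_pdivrMr// ler_peMr ?ltW// ltr1n.
have td0 : 0 < tau * d.+1%:R * 2 by apply: mulr_gt0 => //; apply: mulr_gt0.
(* within eta of the target the two characters differ by at most e' / 2 *)
pose eta := Num.min eta0 (e' / (tau * d.+1%:R * 2)).
have etap : 0 < eta by rewrite lt_min eta00 divr_gt0.
have ele : eta <= eta0 by rewrite ge_min lexx.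
have ele2 : eta <= 1 / 2 by rewrite (le_trans ele).
have elt : tau * d.+1%:R * eta * 2 <= e'.
  have : eta <= e' / (tau * d.+1%:R * 2) by rewrite ge_min lexx orbT.
  by rewrite ler_pdivlMr// mulrC mulrAC.
have [H /andP[H0 HH1] [Nb hNb]] := weight_off_target H1 etap ele2 e'0 sd us.
exists H; rewrite ?H0// => N0.
have [Nm hNm] := weight_mean Hweyl H0 sd us e'0.
have [N2 hN2] := weight_mean Hweyl H0 sd us ltr01.
have mean2 N t : (N2 <= N)%N -> \sum_(n < N) weight a H s t n <= 2 * N%:R.
  by move=> /hN2 h; have := h t; rewrite mul1r ler_norml => /andP[_]; lra.
pose V N (t b : nat -> R) := (\sum_(n < N) weight a H s t n * cos (floor_phase b n)) / N%:R.
pose ok (t : nat -> R) := forall j, j \in s -> eta0 <= t j <= 1 - eta0.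
pose okb (b : nat -> R) := (forall j, j \notin s -> b j = 0) /\ forall j, `|b j| <= 1 / 2.
have okb0 k b : okb b -> okb (zero_at k b).
  move=> [b1 b2]; split=> j; rewrite /zero_at; case: eqP => // _; first exact: b1.
  by rewrite normr0.
have lipV N k : exists K, forall t b, ok t ->
    `|V N t b - V N t (zero_at k b)| <= K * `|b k|.
  exists ((\sum_(n < N) H%:R ^+ size s * (tau * `|(Num.floor (a k n))%:~R|)) / N%:R).
  move=> t b _; rewrite /V -mulrBl -sumrB normrM normfV normr_nat mulrAC.
  rewrite ler_wpM2r// (le_trans (ler_norm_sum _ _ _))// mulr_suml.
  apply: ler_sum => n _; rewrite -mulrBr normrM (ger0_norm (weight_ge0 _ _ _ _ _)) -mulrA.
  apply: ler_pM => //; [exact: weight_ge0|exact: weight_le|].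
  rewrite (le_trans (cos_lip _ _))// /floor_phase -mulrBr normrM (gtr0_norm t0) -[leRHS]mulrA.
  rewrite ler_wpM2l ?(ltW t0)// -sumrB.
  have [kd|dk] := leqP k d; last first.
    rewrite big1 ?normr0 ?mulr_ge0// => j _; rewrite /zero_at ltn_eqF ?subrr//.
    exact: leq_trans (ltn_ord j) dk.
  rewrite (bigD1 (Ordinal (kd : (k < d.+1)%N)))//= big1 ?addr0.
    by rewrite /zero_at eqxx mul0r subr0 normrM mulrC.
  move=> j jk; rewrite /zero_at ifF ?subrr//.
  by apply/negP => /eqP ej; move/eqP: jk; apply; exact: val_inj.
pose M := maxn 1 N2.
have geV N t b : (M <= N)%N -> ok t -> -2 <= V N t b.
  rewrite geq_max => /andP[N_gt0 NN2] _.
  have N0' : 0 < N%:R :> R by rewrite ltr0n.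
  rewrite /V ler_pdivlMr// mulNr lerNl (le_trans _ (mean2 N t NN2))//.
  rewrite -sumrN; apply: ler_sum => n _; rewrite -mulrN -[leRHS]mulr1.
  by apply: ler_wpM2l; [exact: weight_ge0|rewrite lerNl cos_geN1].
have smallV k delta : (k <= d)%N -> 0 < delta ->
    exists N1, forall N t b, (N1 <= N)%N -> ok t -> okb b ->
      (forall j, (j < k)%N -> b j = 0) -> delta <= `|b k| -> - (4 * e') <= V N t b.
  move=> kd d0; pose dl := Num.min delta (1 / 2).
  have dl0 : 0 < dl by rewrite lt_min d0 divr_gt0.
  have dl2 : dl <= 1 / 2 by rewrite ge_min lexx orbT.
  have [N1 hN1] := weighted_small Hweyl H0 sd dl0 dl2 e'0.
  exists (maxn (maxn 1 N2) (maxn N1 Nb)) => N t b.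
  rewrite !geq_max => /andP[/andP[N_gt0 NN2] /andP[NN1 NNb]] tok [bs b2] bk hb.
  have N0' : 0 < N%:R :> R by rewrite ltr0n.
  rewrite /V ler_pdivlMr//.
  have h1 := hN1 N k b t NN1 kd bk (le_trans _ hb) b2.
  have {}h1 : `|\sum_(n < N) weight a H s t n * cos (linear_phase a d b t n)| <= e' * N%:R.
    by apply: h1; rewrite ge_min lexx.
  have h2 : `|\sum_(n < N) weight a H s t n * cos (floor_phase b n) -
     \sum_(n < N) weight a H s t n * cos (linear_phase a d b t n)| <= 3 * e' * N%:R.
    rewrite -sumrB (le_trans (ler_norm_sum _ _ _))//.
    apply: (@le_trans _ _ (\sum_(n < N) (tau * d.+1%:R * eta * weight a H s t n +
         2 * (weight a H s t n * (off_target eta s t n)%:R)))).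
      apply: ler_sum => n _; rewrite -mulrBr normrM (ger0_norm (weight_ge0 _ _ _ _ _)).
      have tok' j : j \in s -> eta <= t j <= 1 - eta.
        move=> /tok/andP[t1 t2]; rewrite (le_trans ele t1) (le_trans t2)// lerD2l lerN2//.
      have := floor_phase_close n etap tok' bs b2.
      move=> /(ler_wpM2l (weight_ge0 a H s t n)) /le_trans; apply.
      by rewrite mulrDr [X in X + _]mulrC [X in _ + X]mulrCA.
    rewrite big_split /= -!mulr_sumr.
    have h3 := hNb N t NNb; have h4 := mean2 N t NN2.
    have h5 : tau * d.+1%:R * eta * \sum_(n < N) weight a H s t n <= e' * N%:R.
      apply: (@le_trans _ _ (tau * d.+1%:R * eta * (2 * N%:R))).
        by apply: ler_wpM2l; [apply: mulr_ge0; [apply: mulr_ge0 => //|]; exact: ltW|].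
      by rewrite mulrA ler_wpM2r.
    rewrite (_ : 3 * e' * N%:R = e' * N%:R + 2 * (e' * N%:R)); last by ring.
    by rewrite lerD// ler_wpM2l.
  move: h1 h2; set A := \sum_(n < N) _; set B := \sum_(n < N) _ => h1 h2.
  have : `|B| <= 4 * e' * N%:R.
    rewrite -(subrK A B) (le_trans (ler_normD _ _))//.
    by rewrite (_ : 4 * e' * N%:R = 3 * e' * N%:R + e' * N%:R) ?lerD//; ring.
  by rewrite ler_norml mulNr => /andP[].
have zeroV N t b : (M <= N)%N -> ok t ->
    (forall j, (j <= d)%N -> b j = 0) -> - (4 * e') <= V N t b.
  move=> _ _ bz; rewrite (@le_trans _ _ 0)//; first by rewrite oppr_le0 mulr_ge0// ltW.
  rewrite /V divr_ge0// sumr_ge0// => n _.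
  rewrite /floor_phase big1 ?mulr0 ?cos0 ?mulr1 ?weight_ge0// => j _.
  by rewrite bz ?mul0r// -ltnS.
have e4 : 0 <= 4 * e' by rewrite mulr_ge0// ltW.
have e2 : 0 < e / 2 by rewrite divr_gt0.
have [Q wQ hQ] := multiscale e4 okb0 lipV geV smallV zeroV (maxn (maxn 1 N0) (maxn Nb Nm)) e2.
exists Q.
  case: wQ => Q1 Q2; split => // q /Q1[h1]; rewrite !geq_max => /andP[/andP[_ h2] _]; by split.
split.
  move=> q t /(wQ.1)[_]; rewrite !geq_max => /andP[/andP[q0 _] /andP[qb qm]]; split => //.
    by rewrite (le_trans (hNm _ t qm))// ler_wpM2r.
  apply: (@le_trans _ _ (e' * q.2%:R)); last by rewrite ler_wpM2r.
  apply: le_trans (hNb _ t qb); apply: ler_sum => n _.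
  by rewrite ler_wpM2l ?weight_ge0// ler_nat; exact: off_target_le.
move=> t b tok bs; have [b' [b2 b0 bE]] := floor_phase_reduce b.
have := hQ t b' tok; rewrite (_ : 4 * e' + e / 2 = e); last by rewrite /e'; field.
move=> /(_ (conj (fun j js => b0 j (bs j js)) b2)) /le_trans; apply.
rewrite le_eqVlt; apply/orP; left; apply/eqP; apply: eq_bigr => q _; congr (_ * _).
by rewrite /V; congr (_ / _); apply: eq_bigr => n _; rewrite bE.
Qed.

End Core.

(** * Correlations of a finite set *)

Section Correlation.
Variable R : realType.
Local Notation tau := (tau R).
Variables (E : pred nat) (X M : nat).

Let Q := (X + M)%N.
Let ind (x : nat) : R := (E x)%:R.

(** The number of pairs of E (below X) at distance m. *)
Definition corr (m : nat) : R :=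
  \sum_(x < X) \sum_(y < X) ind x * ind y * (y == (x + m)%N :> nat)%:R.

Definition mass : R := \sum_(x < X) ind x.

(** The squared absolute value, divided by Q, of the discrete Fourier
transform of E on the cyclic group of order Q = X + M; the extra length M
prevents distances m <= M from wrapping around. *)
Definition spectrum (xi : nat) : R := Q%:R^-1 *
  \sum_(x < X) \sum_(y < X) ind x * ind y * cos (tau * (xi%:R / Q%:R) * (y%:R - x%:R)).

Lemma spectrum_ge0 xi : 0 <= spectrum xi.
Proof.
rewrite /spectrum mulr_ge0 ?invr_ge0//; set th := tau * _.
have -> : \sum_(x < X) \sum_(y < X) ind x * ind y * cos (th * (y%:R - x%:R)) =
  (\sum_(x < X) ind x * cos (th * x%:R)) ^+ 2 + (\sum_(x < X) ind x * sin (th * x%:R)) ^+ 2.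
  rewrite !expr2 !mulr_suml -big_split; apply: eq_bigr => x _ /=.
  rewrite !mulr_sumr -big_split; apply: eq_bigr => y _ /=.
  by rewrite mulrBr cosB; ring.
by rewrite addr_ge0// sqr_ge0.
Qed.

Lemma spectrum0 : spectrum 0 = mass ^+ 2 / Q%:R.
Proof.
rewrite /spectrum mulrC; congr (_ * _); rewrite /mass expr2 mulr_suml.
apply: eq_bigr => x _; rewrite mulr_sumr; apply: eq_bigr => y _.
by rewrite mul0r mulr0 mul0r cos0 mulr1.
Qed.

(** Exchanging x and y shows that the sine part vanishes. *)
Lemma spectrum_cos xi psi (m : nat) :
  spectrum xi * cos (psi + tau * (xi%:R / Q%:R) * m%:R) = Q%:R^-1 *
   \sum_(x < X) \sum_(y < X) ind x * ind y *
      cos (psi + tau * ((m%:Z - (y%:Z - x%:Z))%:~R * (xi%:R / Q%:R))).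
Proof.
rewrite /spectrum -[LHS]mulrA; congr (_ * _); set th := tau * (xi%:R / Q%:R).
set A := psi + th * m%:R.
have -> : \sum_(x < X) \sum_(y < X) ind x * ind y *
      cos (psi + tau * ((m%:Z - (y%:Z - x%:Z))%:~R * (xi%:R / Q%:R))) =
  (\sum_(x < X) \sum_(y < X) ind x * ind y * cos (th * (y%:R - x%:R))) * cos A +
  (\sum_(x < X) \sum_(y < X) ind x * ind y * sin (th * (y%:R - x%:R))) * sin A.
  rewrite !mulr_suml -big_split; apply: eq_bigr => x _ /=.
  rewrite !mulr_suml -big_split; apply: eq_bigr => y _ /=.
  have -> : psi + tau * ((m%:Z - (y%:Z - x%:Z))%:~R * (xi%:R / Q%:R)) = A - th * (y%:R - x%:R).
    by rewrite /A /th intrB intrB; ring.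
  by rewrite cosB; ring.
have -> : \sum_(x < X) \sum_(y < X) ind x * ind y * sin (th * (y%:R - x%:R)) = 0.
  set S := LHS; suff : S = - S by lra.
  rewrite /S -sumrN exchange_big /=; apply: eq_bigr => x _.
  rewrite -sumrN; apply: eq_bigr => y _; rewrite -mulrN -sinN [ind y * _]mulrC.
  by congr (_ * sin _); ring.
by rewrite mul0r addr0.
Qed.

(** Fourier inversion; the phase psi is carried along so that the formula can
be used inside products. *)
Lemma corr_spectrum psi m : (0 < X)%N -> (m <= M)%N ->
  corr m * cos psi = \sum_(xi < Q) spectrum xi * cos (psi + tau * (xi%:R / Q%:R) * m%:R).
Proof.
move=> X0 mM; have Q_gt0 : (0 < Q)%N by rewrite addn_gt0 X0.
have Q0 : 0 < Q%:R :> R by rewrite ltr0n.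
under eq_bigr do rewrite spectrum_cos.
rewrite -mulr_sumr exchange_big /=.
under eq_bigr do rewrite exchange_big /=.
rewrite mulr_suml mulr_sumr; apply: eq_bigr => x _.
rewrite mulr_suml mulr_sumr; apply: eq_bigr => y _.
rewrite -mulr_sumr mulrCA -mulrA; congr (_ * _).
case: eqP => [yxm|yxm].
  have -> : m%:Z - (y%:Z - x%:Z) = 0 by rewrite yxm PoszD; lia.
  under eq_bigr do rewrite mul0r mulr0 addr0.
  by rewrite sumr_const card_ord -[X in _ = _ * X]mulr_natl mulrA mulVf ?mul1r// gt_eqF.
rewrite mul0r (@cos_sum_period R Q) ?mulr0//.
  by apply/eqP => h; apply: yxm; lia.
have := ltn_ord x; have := ltn_ord y; rewrite /Q; lia.
Qed.

Lemma spectrum_sum : (0 < X)%N -> \sum_(xi < Q) spectrum xi = mass.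
Proof.
move=> X0; have := corr_spectrum 0 X0 (leq0n M); rewrite cos0 mulr1.
have -> : corr 0 = mass.
  apply: eq_bigr => x _; rewrite (bigD1 x)//= addn0 eqxx mulr1 big1 ?addr0.
    by rewrite /ind; case: (E x); rewrite ?mulr1 ?mulr0.
  by move=> y yx; rewrite (_ : (y == x :> nat) = false) ?mulr0//; apply/negbTE.
by move=> ->; apply: eq_bigr => xi _; rewrite mulr0 addr0 cos0 mulr1.
Qed.

Lemma corr_le_mass m : 0 <= corr m <= mass.
Proof.
apply/andP; split.
  by apply: sumr_ge0 => x _; apply: sumr_ge0 => y _; rewrite !mulr_ge0 /ind ?ler0n.
apply: ler_sum => x _; have [xX|Xx] := ltnP (x + m) X; last first.
  rewrite big1 ?ler0n// => y _; rewrite (_ : (y == x + m :> nat)%N = false) ?mulr0//.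
  by apply/negbTE/eqP => h; move: Xx; rewrite -h leqNgt ltn_ord.
rewrite (bigD1 (Ordinal xX))//= eqxx mulr1 big1 ?addr0.
  by rewrite /ind; case: (E _); case: (E _); rewrite ?mulr1 ?mulr0 ?lexx ?ler01 ?ler0n.
move=> y yx; rewrite (_ : (y == x + m :> nat)%N = false) ?mulr0//.
by apply/negbTE/eqP => h; move/eqP: yx; apply; exact: val_inj.
Qed.

Lemma corr_gt0 m : 0 < corr m -> exists x, E x /\ E (x + m)%N.
Proof.
move=> c0; apply: contrapT => h; move: c0; rewrite /corr big1 ?ltxx// => x _.
rewrite big1// => y _; case: eqP => [->|_]; last by rewrite mulr0.
rewrite /ind; case: (boolP (E x)) => Ex; last by rewrite !mul0r.
case: (boolP (E (x + m)%N)) => Ey; last by rewrite mulr0 mul0r.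
by exfalso; apply: h; exists x.
Qed.

Lemma mass_le : mass <= X%:R.
Proof.
rewrite -[X in leRHS](card_ord X) -sum1_card natr_sum; apply: ler_sum => x _.
by rewrite /ind; case: (E x).
Qed.

Variables (Lam : (nat -> R) -> R) (B J : nat) (m_ : nat -> nat -> nat) (e : R).
Hypothesis X_gt0 : (0 < X)%N.
Hypothesis mass_gt0 : 0 < mass.
Hypothesis e_ge0 : 0 <= e.
Hypothesis LamE : forall g g', (forall n, (n < B)%N -> g n = g' n) -> Lam g = Lam g'.
Hypothesis Lam_lin : forall (L : nat) (c : nat -> R) (g : nat -> nat -> R),
  Lam (fun n => \sum_(i < L) c i * g i n) = \sum_(i < L) c i * Lam (g i).
Hypothesis m_le : forall j n, (j < J)%N -> (n < B)%N -> (m_ j n <= M)%N.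
Hypothesis Lam_cos : forall b : nat -> R,
  - e <= Lam (fun n => cos (tau * \sum_(j < J) b j * (m_ j n)%:R)).

Let prod_corr i n := \prod_(j < i) (corr (m_ j n) / mass).

Lemma prod_corr_rec i (b : nat -> R) n : (i < J)%N -> (n < B)%N ->
  prod_corr i.+1 n * cos (tau * \sum_(j < J) b j * (m_ j n)%:R) =
  \sum_(xi < Q) (spectrum xi / mass) * (prod_corr i n *
      cos (tau * \sum_(j < J) shift_at b i (xi%:R / Q%:R) j * (m_ j n)%:R)).
Proof.
move=> iJ nB; rewrite /prod_corr big_ord_recr /= -/(prod_corr i n).
set psi := tau * _; rewrite -[_ * _ * cos psi]mulrA.
have -> : corr (m_ i n) / mass * cos psi = mass^-1 * (corr (m_ i n) * cos psi) by ring.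
rewrite corr_spectrum ?m_le// !mulr_sumr; apply: eq_bigr => xi _.
have -> : tau * \sum_(j < J) shift_at b i (xi%:R / Q%:R) j * (m_ j n)%:R =
    psi + tau * (xi%:R / Q%:R) * (m_ i n)%:R.
  rewrite /psi -mulrA -mulrDr; congr (_ * _).
  rewrite (bigD1 (Ordinal iJ))//= [in RHS](bigD1 (Ordinal iJ))//=.
  rewrite [in LHS]/shift_at eqxx mulrDl addrAC; congr (_ + _ + _).
  apply: eq_bigr => j ji; rewrite /shift_at ifF//.
  by apply/negP => /eqP ej; move/eqP: ji; apply; exact: val_inj.
ring.
Qed.

(** Each normalised correlation is an average of cosines, so a product of
correlations is an average of characters in several frequencies, each bounded
below by hypothesis. *)
Lemma Lam_prod_cos i (b : nat -> R) : (i <= J)%N ->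
  - e <= Lam (fun n => prod_corr i n * cos (tau * \sum_(j < J) b j * (m_ j n)%:R)).
Proof.
elim: i b => [|i IH] b iJ.
  rewrite (LamE (g' := fun n => cos (tau * \sum_(j < J) b j * (m_ j n)%:R)))// => n _.
  by rewrite /prod_corr big_ord0 mul1r.
rewrite (LamE (g' := fun n => \sum_(xi < Q) (spectrum xi / mass) * (prod_corr i n *
      cos (tau * \sum_(j < J) shift_at b i (xi%:R / Q%:R) j * (m_ j n)%:R)))); last first.
  by move=> n nB; exact: prod_corr_rec.
rewrite (Lam_lin Q (fun xi => spectrum xi / mass)
  (fun xi n => prod_corr i n * cos (tau * \sum_(j < J) shift_at b i (xi%:R / Q%:R) j * (m_ j n)%:R))).
apply: (@le_trans _ _ (\sum_(xi < Q) (spectrum xi / mass) * - e)).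
  by rewrite -mulr_suml -mulr_suml spectrum_sum// divff ?mul1r// gt_eqF.
apply: ler_sum => xi _; apply: ler_wpM2l; last by apply: IH; exact: ltnW.
by rewrite divr_ge0 ?spectrum_ge0// ltW.
Qed.

(** In the expansion of the last correlation the zero frequency has weight
mass / Q; the other frequencies are bounded below by [Lam_prod_cos]. *)
Lemma Lam_prod i : (i <= J)%N ->
  (mass / Q%:R) ^+ i * Lam (fun=> 1) - i%:R * e <= Lam (prod_corr i).
Proof.
have Q0 : 0 < Q%:R :> R by rewrite ltr0n addn_gt0 X_gt0.
elim: i => [|i IH] iJ.
  rewrite expr0 mul1r mul0r subr0 (LamE (g' := prod_corr 0))// => n _.
  by rewrite /prod_corr big_ord0.
rewrite (LamE (g := prod_corr i.+1) (g' := fun n => \sum_(xi < Q) (spectrum xi / mass) * (prod_corr i n *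
      cos (tau * \sum_(j < J) shift_at (fun=> 0 : R) i (xi%:R / Q%:R) j * (m_ j n)%:R)))); last first.
  move=> n nB; rewrite -prod_corr_rec//; rewrite [X in cos (_ * X)]big1 ?mulr0 ?cos0 ?mulr1// => j _.
  by rewrite mul0r.
rewrite (Lam_lin Q (fun xi => spectrum xi / mass)
  (fun xi n => prod_corr i n * cos (tau * \sum_(j < J) shift_at (fun=> 0 : R) i (xi%:R / Q%:R) j * (m_ j n)%:R))).
have Q_gt0 : (0 < Q)%N by rewrite addn_gt0 X_gt0.
rewrite (bigD1 (Ordinal Q_gt0))//=.
have -> : spectrum 0 / mass = mass / Q%:R.
  by rewrite spectrum0; field; rewrite !gt_eqF.
have -> : Lam (fun n => prod_corr i n *
    cos (tau * \sum_(j < J) shift_at (fun=> 0 : R) i (0%:R / Q%:R) j * (m_ j n)%:R)) =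
  Lam (prod_corr i).
  apply: LamE => n nB; rewrite [X in cos (_ * X)]big1 ?mulr0 ?cos0 ?mulr1// => j _.
  by rewrite /shift_at mul0r addr0; case: eqP; rewrite mul0r.
have p0 : 0 <= mass / Q%:R by rewrite divr_ge0// ltW.
have p1 : mass / Q%:R <= 1.
  by rewrite ler_pdivrMr// mul1r (le_trans mass_le)// ler_nat leq_addr.
have rest : - e <= \sum_(xi < Q | xi != Ordinal Q_gt0) spectrum xi / mass *
   Lam (fun n => prod_corr i n * cos (tau * \sum_(j < J) shift_at (fun=> 0 : R) i (xi%:R / Q%:R) j * (m_ j n)%:R)).
  apply: (@le_trans _ _ (\sum_(xi < Q | xi != Ordinal Q_gt0) (spectrum xi / mass) * - e)).
    rewrite -mulr_suml mulrN lerN2 ler_piMl// -mulr_suml ler_pdivrMr// mul1r.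
    rewrite -(spectrum_sum X_gt0) [leRHS](bigD1 (Ordinal Q_gt0))//= lerDr; exact: spectrum_ge0.
  apply: ler_sum => xi _; apply: ler_wpM2l; last by apply: Lam_prod_cos; exact: ltnW.
  by rewrite divr_ge0 ?spectrum_ge0// ltW.
have h := ler_wpM2l p0 (IH (ltnW iJ)).
have h2 : mass / Q%:R * (i%:R * e) <= i%:R * e by rewrite ler_piMl// mulr_ge0.
rewrite exprS -natr1; move: h h2 rest; set p := mass / Q%:R.
set L := Lam (prod_corr i); set L1 := Lam (fun=> 1); set S := \sum_(_ < _ | _) _.
move=> h h2 rest; rewrite mulrBr in h.
have -> : p * p ^+ i * L1 - (i%:R + 1) * e = (p * (p ^+ i * L1) - i%:R * e) + - e by ring.
apply: lerD => //; apply: le_trans h; by rewrite lerD2l lerN2.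
Qed.

End Correlation.

(** * Recurrence along weighted averages *)

Section Recurrence.
Variable R : realType.
Local Notation tau := (tau R).

Definition wavg (Q : seq (R * nat)) (v g : nat -> R) : R :=
  \sum_(q <- Q) q.1 * ((\sum_(n < q.2) v n * g n) / q.2%:R).

Lemma wavg_lin Q v (L : nat) (c : nat -> R) (g : nat -> nat -> R) :
  wavg Q v (fun n => \sum_(i < L) c i * g i n) = \sum_(i < L) c i * wavg Q v (g i).
Proof.
rewrite /wavg; under [in RHS]eq_bigr do rewrite mulr_sumr.
rewrite exchange_big /=; apply: eq_bigr => q _.
under [in RHS]eq_bigr do rewrite mulrCA.
rewrite -mulr_sumr; congr (_ * _).
under [in RHS]eq_bigr do rewrite mulrA.
rewrite -mulr_suml; congr (_ / _).
under [in RHS]eq_bigr do rewrite mulr_sumr.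
rewrite exchange_big /=; apply: eq_bigr => n _.
by rewrite mulr_sumr; apply: eq_bigr => i _; rewrite mulrCA.
Qed.

Lemma wavg_ext Q v g g' : (forall n, (n < \sum_(q <- Q) q.2)%N -> g n = g' n) ->
  wavg Q v g = wavg Q v g'.
Proof.
move=> h; rewrite /wavg big_seq_cond [RHS]big_seq_cond; apply: eq_bigr => q.
rewrite andbT => qQ; congr (_ * (_ / _)); apply: eq_bigr => n _.
rewrite h// (leq_trans (ltn_ord n))// (big_rem q)//=; exact: leq_addr.
Qed.

(** Apply [Lam_prod] to the part of S below a bound X so large that the loss
from the distances m_ j n is negligible. The function f is the product of the
normalised correlations at distances m_ j n. *)
Lemma recurrence (S : set nat) (p delta e : R) Q v J (m_ : nat -> nat -> nat) :
  0 < p -> (forall n, p * n%:R <= (cnt S 0 n)%:R) -> 0 < delta -> delta <= 1 -> 0 <= e ->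
  (forall b : nat -> R,
    - e <= wavg Q v (fun n => cos (tau * \sum_(j < J) b j * (m_ j n)%:R))) ->
  0 <= wavg Q v (fun=> 1) ->
  exists f, [/\ forall n, 0 <= f n <= 1,
    forall n j, 0 < f n -> (j < J)%N -> exists x, S x /\ S (x + m_ j n)%N &
    (p * (1 - delta)) ^+ J * wavg Q v (fun=> 1) - J%:R * e <= wavg Q v f].
Proof.
move=> p0 hS d0 d1 e0 hcos h1.
pose B := (\sum_(q <- Q) q.2)%N.
pose M := (\sum_(j < J) \sum_(n < B) m_ j n)%N.
(* so that Y / (Y + 1 + M) >= 1 - delta *)
pose Y := (Num.truncn ((1 + M%:R) / delta)).+1.
have Y0 : 0 < Y%:R :> R by rewrite ltr0n.
have hY : 1 + M%:R <= delta * Y%:R.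
  by rewrite mulrC -ler_pdivrMr// ltW//; exact: truncnS_gt.
pose E x := x \in S.
have massE : p * Y%:R <= mass R E Y.+1.
  apply: (le_trans (hS Y)); rewrite /mass.
  have -> : \sum_(x < Y.+1) (E x)%:R = (count (fun j => j \in S) (iota 0 Y.+1))%:R :> R.
    by rewrite -sum_shift_count; apply: eq_bigr => x _; rewrite addn0.
  by rewrite ler_nat /cnt /= leq_addl.
have mass0 : 0 < mass R E Y.+1 by rewrite (lt_le_trans _ massE)// mulr_gt0.
have Q0 : 0 < (Y.+1 + M)%:R :> R by rewrite ltr0n addSn.
have ratio : p * (1 - delta) <= mass R E Y.+1 / (Y.+1 + M)%:R.
  rewrite ler_pdivlMr// (le_trans _ massE)// -mulrA ler_pM2l//.
  rewrite natrD -natr1; move: hY; set y := Y%:R; set z := M%:R => hY.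
  have -> : (1 - delta) * (y + 1 + z) = y - (delta * y - (1 + z)) - delta * (1 + z) by ring.
  rewrite -addrA gerDl -opprD oppr_le0 addr_ge0 ?subr_ge0//.
  by rewrite mulr_ge0 ?addr_ge0 ?(ltW d0)// /z.
have mle j n : (j < J)%N -> (n < B)%N -> (m_ j n <= M)%N.
  move=> jJ nB; rewrite /M (bigD1 (Ordinal jJ))//= (bigD1 (Ordinal nB))//= -addnA leq_addr //.
have corr1 m : 0 <= corr R E Y.+1 m / mass R E Y.+1 <= 1.
  have /andP[c0 c1] := corr_le_mass R E Y.+1 m.
  by rewrite divr_ge0 ?(ltW mass0)//= ler_pdivrMr// mul1r.
exists (fun n => \prod_(j < J) (corr R E Y.+1 (m_ j n) / mass R E Y.+1)); split.
- move=> n; apply/andP; split; first by apply: prodr_ge0 => j _; case/andP: (corr1 (m_ j n)).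
  by apply: prodr_ile1 => j _; exact: corr1.
- move=> n j fn jJ; have c0 : 0 < corr R E Y.+1 (m_ j n).
    rewrite lt_neqAle eq_sym; have /andP[-> _] := corr_le_mass R E Y.+1 (m_ j n).
    rewrite andbT; apply/eqP => cz; move: fn.
    by rewrite (bigD1 (Ordinal jJ))//= cz !mul0r ltxx.
  have [x [/set_mem Sx /set_mem Sxm]] := corr_gt0 c0; by exists x.
- have := @Lam_prod R E Y.+1 M (wavg Q v) B J m_ e isT mass0 e0 (@wavg_ext Q v) (wavg_lin Q v) mle hcos J (leqnn J).
  apply: le_trans; rewrite lerD2r ler_wpM2r//.
  by apply: lerXn2r; rewrite ?nnegrE ?mulr_ge0 ?divr_ge0 ?(ltW p0) ?(ltW mass0) ?subr_ge0.
Qed.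

End Recurrence.

(** * Return times along the integral parts of n^c *)

Section Returns.
Variable R : realType.
Local Notation tau := (tau R).
Variable c : R.
Hypothesis c_gt0 : 0 < c.
Hypothesis c_nat : c \isn't a Num.nat.

Let d := Num.truncn c.

Lemma truncn_lt : d%:R < c < d.+1%:R.
Proof.
have /andP[h1 h2] := truncn_itv (ltW c_gt0); rewrite h2 andbT lt_neqAle h1 andbT.
by apply/eqP => dc; move: c_nat; rewrite -dc natr_nat.
Qed.

Lemma weyl_family_powdif : weyl_family (powdif c) d.
Proof.
move=> delta C e delta0 e0; have /andP[dc _] := truncn_lt.
have [N1 hN1] := phase_all_small C dc c_nat delta0 e0.
by exists N1 => N i g phi NN id hl; exact: hN1 hl.
Qed.

Lemma floor_truncn (x : R) : 0 <= x -> (Num.floor x)%:~R = (Num.truncn x)%:R :> R.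
Proof.
by move=> x0; rewrite truncn_floor x0 natr_absz ger0_norm ?floor_ge0.
Qed.

Lemma floor_powdif0 n : (Num.floor (powdif c 0 n))%:~R = (ipow c n)%:R :> R.
Proof. by rewrite /powdif /= floor_truncn ?powR_ge0. Qed.

Lemma wsum_le (Q : seq (R * nat)) N0 (F G : R * nat -> R) (x : R) : wlist 1 N0 Q ->
  (forall q, q \in Q -> G q <= F q + x) ->
  \sum_(q <- Q) q.1 * G q <= \sum_(q <- Q) q.1 * F q + x.
Proof.
move=> [Q0 Q1] h; rewrite -[x in leRHS]mul1r -Q1 mulr_suml -big_split /=.
rewrite big_seq_cond [leRHS]big_seq_cond; apply: ler_sum => q; rewrite andbT => qQ.
by have [q0 _] := Q0 q qQ; rewrite -mulrDr ler_wpM2l// h.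
Qed.

Lemma ler_wavg Q N0 r (v f g : nat -> R) : wlist r N0 Q -> (forall n, 0 <= v n) ->
  (forall n, f n <= g n) -> wavg Q v f <= wavg Q v g.
Proof.
move=> [Q0 _] v0 fg; rewrite /wavg big_seq_cond [leRHS]big_seq_cond; apply: ler_sum => q.
rewrite andbT => /Q0[q0 _]; rewrite ler_wpM2l// ler_wpM2r ?invr_ge0//.
by apply: ler_sum => n _; rewrite ler_wpM2l.
Qed.

Lemma wavg_ge0 Q N0 r (v f : nat -> R) : wlist r N0 Q -> (forall n, 0 <= v n) ->
  (forall n, 0 <= f n) -> 0 <= wavg Q v f.
Proof.
move=> [Q0 _] v0 f0; rewrite /wavg big_seq_cond; apply: sumr_ge0 => q.
rewrite andbT => /Q0[q0 _]; rewrite mulr_ge0// divr_ge0// sumr_ge0// => n _.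
by rewrite mulr_ge0.
Qed.

Lemma sum_ltn_ind N m : \sum_(n < N) (n < m)%N%:R = (minn N m)%:R :> R.
Proof.
elim: N => [|N IH]; first by rewrite big_ord0 min0n.
rewrite big_ord_recr /= IH -natrD; congr (_%:R).
by case: ltnP => h; lia.
Qed.

Variables (S : set nat) (p : R).
Hypothesis S_pos : S `<=` posnats.
Hypothesis p_gt0 : 0 < p.
Hypothesis hS : forall n, p * n%:R <= (cnt S 0 n)%:R.

Lemma p_le1 : p <= 1.
Proof. by have := hS 1; rewrite mulr1 => /le_trans; apply; rewrite (ler_nat _ _ 1) cnt_le. Qed.

Lemma Delta1P n x : (0 < n)%N -> S x -> S (x + ipow c n)%N -> Delta1 c S n.
Proof.
move=> n0 Sx Sxm; split => //; exists x; split => //; split => //; exact: S_pos.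
Qed.

(** A single correlation at distance [n^c], for the weight with target r / H.
It is at most 1 and vanishes unless n = 0 or n is a return time. *)
Lemma grid_return H (delta : R) Q N0 (r : nat) :
  (0 < H)%N -> 0 < delta -> delta <= 1 -> wlist 1 N0 Q ->
  (forall q t, q \in Q -> (0 < q.2)%N /\
     `|\sum_(n < q.2) weight (powdif c) H [:: 0%N] t n - q.2%:R| <= delta * q.2%:R) ->
  (forall b : nat -> R, (forall j, j \notin [:: 0%N] -> b j = 0) ->
     - delta <= \sum_(q <- Q) q.1 * ((\sum_(n < q.2)
        weight (powdif c) H [:: 0%N] (fun=> r%:R / H%:R) n * cos (floor_phase (powdif c) d b n)) / q.2%:R)) ->
  p * (1 - delta) * (1 - delta) - delta <=
    wavg Q (weight (powdif c) H [:: 0%N] (fun=> r%:R / H%:R))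
       (fun n => (`[< n = 0%N \/ Delta1 c S n >])%:R).
Proof.
move=> H0 d0 d1 wQ hmean hcos; set v := weight _ _ _ _.
have v0 n : 0 <= v n by exact: weight_ge0.
have mean1 : 1 - delta <= wavg Q v (fun=> 1).
  rewrite /wavg lerBlDr.
  have one : \sum_(q <- Q) q.1 * 1 = 1 by under eq_bigr do rewrite mulr1; exact: wQ.2.
  rewrite -[leLHS]one.
  apply: (wsum_le wQ) => q qQ; have [q0 hq] := hmean q (fun=> r%:R / H%:R) qQ.
  have q0' : 0 < q.2%:R :> R by rewrite ltr0n.
  rewrite -lerBlDr ler_pdivlMr//; under eq_bigr do rewrite mulr1.
  by move: hq; rewrite ler_norml => /andP[+ _]; rewrite /v; lra.
have := @recurrence R S p delta delta Q v 1 (fun _ n => ipow c n) p_gt0 hS d0 d1 (ltW d0) _ _.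
case.
- move=> b; pose b' j := if j == 0%N then b 0%N else 0.
  apply: (le_trans (hcos b' _)).
    by move=> j; rewrite inE /b' => /negbTE ->.
  rewrite le_eqVlt; apply/orP; left; apply/eqP; rewrite /wavg.
  apply: eq_bigr => q _; congr (_ * (_ / _)); apply: eq_bigr => n _.
  congr (_ * cos (_ * _)); rewrite big_ord1 big_ord_recl big1 ?addr0.
    by rewrite floor_powdif0.
  by move=> i _; rewrite /b' mul0r.
- by rewrite (le_trans _ mean1)// subr_ge0.
move=> f [f01 fret hf].
rewrite expr1 mul1r in hf.
apply: (@le_trans _ _ (wavg Q v f)).
  apply: le_trans hf; rewrite lerD2r ler_wpM2l// mulr_ge0 ?(ltW p_gt0)// subr_ge0//.
apply: (ler_wavg wQ) => // n.
have /andP[f0 f1] := f01 n.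
case: asboolP => // hn; rewrite leNgt; apply/negP => fn; apply: hn.
have [->|n0] := posnP n; [by left|right].
by have [x [Sx Sxm]] := fret n 0%N fn isT; exact: Delta1P Sxm.
Qed.

(** Summing the bounds of [grid_return] over the targets r / H that are not too
close to 0 or 1 recovers the unweighted averages, because the weights form a
partition of unity. Hence some scale N carries nearly a proportion p of return
times. *)
Lemma Delta1_density : p <= upper_density R (Delta1 c S).
Proof.
apply/ler_addgt0Pr => eps eps0; rewrite -lerBlDr.
apply: upper_density_ge => N0.
(* the losses below amount to at most 8 dl; 16 dl leaves room for strict
   inequalities *)
pose dl := Num.min (eps / 16) (1 / 16).
have dl0 : 0 < dl by rewrite lt_min !divr_gt0.
have dle : 16 * dl <= eps by rewrite mulrC -ler_pdivlMr// ge_min lexx.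
have dl16 : 16 * dl <= 1 by rewrite mulrC -ler_pdivlMr// ge_min lexx orbT.
have dl1 : dl <= 1 by rewrite (le_trans _ dl16)// ler_peMl ?ltW// ltr1n.
have dl2 : dl <= 1 / 2 by move: dl16; move: (dl) => y; lra.
pose H1 := (Num.truncn (1 / dl)).+1.
have H1dl n : (H1 <= n)%N -> 1 <= dl * n%:R.
  move=> Hn; rewrite mulrC -ler_pdivrMr// ltW// (lt_le_trans (truncnS_gt _))//.
  by rewrite ler_nat.
have [H /andP[H0 HH1] hH] := @weight_core R (powdif c) d weyl_family_powdif [:: 0%N] dl dl H1
   isT isT dl0 dl2 dl0.
have [Q wQ [hq hcos]] := hH (maxn N0 H1).
have H0' : 0 < H%:R :> R by rewrite ltr0n.
apply: contrapT => hno.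
have hfreq N : (N0 <= N)%N -> freq R (Delta1 c S) N < p - eps.
  by move=> NN; rewrite ltNge; apply/negP => h; apply: hno; exists N.
pose I n : R := (`[< n = 0%N \/ Delta1 c S n >])%:R.
have I0 n : 0 <= I n by rewrite /I.
pose Yv := p * (1 - dl) * (1 - dl) - dl.
(* the targets r / H with u <= r < H - u are at distance at least dl from 0
   and 1 *)
pose u := (Num.truncn (dl * H%:R)).+1.
pose v (r : nat) := weight (powdif c) H [:: 0%N] (fun=> r%:R / H%:R).
have uH : dl * H%:R < u%:R by exact: truncnS_gt.
have u2 : u%:R <= 2 * (dl * H%:R).
  rewrite -[u%:R]natr1 [leRHS]mulr_natl mulr2n lerD ?H1dl//.
  by rewrite truncn_le// mulr_ge0// ltW.
have uu : (u + u <= H)%N.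
  rewrite -(ler_nat R) natrD.
  have : 16 * dl * H%:R <= 1 * H%:R by rewrite ler_wpM2r// ltW.
  move: u2 H0'; set x := u%:R; set y := H%:R; move: (dl) => z; nra.
have grid r : (u <= r)%N -> (r < H - u)%N -> Yv <= wavg Q (v r) I.
  move=> ur rH; apply: (grid_return H0 dl0 dl1 wQ).
    by move=> q t qQ; have [] := hq q t qQ.
  move=> b hb; apply: hcos => // j _.
  rewrite ler_pdivlMr// ler_pdivrMr// mulrBl mul1r; apply/andP; split.
    by rewrite (le_trans (ltW uH))// ler_nat.
  rewrite lerBrDr (le_trans (_ : _ <= r%:R + u%:R))// ?lerD2l ?(ltW uH)//.
  by move: rH; rewrite -natrD ler_nat ltn_subRL addnC; exact: ltnW.
have total : \sum_(0 <= r < H) wavg Q (v r) I <= H%:R * (p - eps + dl).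
  rewrite /wavg exchange_big /=.
  have -> : \sum_(q <- Q) \sum_(0 <= r < H) q.1 * ((\sum_(n < q.2) v r n * I n) / q.2%:R) =
     \sum_(q <- Q) q.1 * (H%:R * ((\sum_(n < q.2) I n) / q.2%:R)).
    apply: eq_bigr => q _; rewrite -mulr_sumr -mulr_suml [H%:R * _]mulrA; congr (_ * (_ / _)).
    rewrite exchange_big /= mulr_sumr; apply: eq_bigr => n _.
    rewrite -mulr_suml; congr (_ * _); rewrite big_mkord -[RHS](fejer_partition (powdif c 0 n) H0).
    by apply: eq_bigr => r _; rewrite /v /weight big_seq1.
  have := @wsum_le Q _ (fun=> 0) (fun q => H%:R * ((\sum_(n < q.2) I n) / q.2%:R))
    (H%:R * (p - eps + dl)) wQ.
  rewrite [\sum_(q <- Q) q.1 * 0]big1 ?add0r; last by move=> q _; rewrite mulr0.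
  apply=> q qQ; rewrite ler_pM2l//.
  have [_ /(_ q qQ)[_]] := (wQ.2, wQ.1); rewrite geq_max => /andP[qN qH].
  have q0 : (0 < q.2)%N by apply: leq_trans qH.
  have q0' : 0 < q.2%:R :> R by rewrite ltr0n.
  rewrite ler_pdivrMr// mulrDl.
  apply: (@le_trans _ _ ((cnt (Delta1 c S) 0 q.2)%:R + 1)).
    case: (q.2) q0 => // m _; rewrite big_ord_recl addrC lerD//; last first.
      by rewrite /I; case: asboolP.
    have -> : (cnt (Delta1 c S) 0 m.+1)%:R = \sum_(x < m.+1) ((x + 1)%N \in Delta1 c S)%:R :> R.
      by rewrite sum_shift_count.
    rewrite big_ord_recr /= -[leLHS]addr0 lerD ?ler0n//.
    apply: ler_sum => i _; rewrite /I /bump /= add1n addn1.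
    case: asboolP => [[//|h]|_]; last by rewrite ler0n.
    by rewrite mem_set.
  rewrite lerD ?H1dl// -ler_pdivrMr//; exact/ltW/hfreq.
have low : (H - u - u)%:R * Yv <= \sum_(0 <= r < H) wavg Q (v r) I.
  have uH' : (u <= H)%N by rewrite (leq_trans _ uu)// leq_addr.
  have uHu : (u <= H - u)%N by rewrite leq_subRL.
  rewrite (big_cat_nat (leq0n u) uH') (big_cat_nat uHu (leq_subr u H)) /=.
  have nn m n : 0 <= \sum_(m <= r < n) wavg Q (v r) I.
    by apply: sumr_ge0 => r _; apply: (wavg_ge0 wQ) => // k; exact: weight_ge0.
  rewrite -[leLHS]add0r lerD// -[leLHS]addr0 lerD//.
  have -> : (H - u - u)%:R * Yv = \sum_(u <= r < H - u) Yv.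
    by rewrite big_const_nat iter_addr_0 mulr_natl.
  by apply: ler_sum_nat => r /andP[? ?]; exact: grid.
have := le_trans low total.
have -> : (H - u - u)%:R = H%:R - (u%:R + u%:R) :> R.
  by rewrite -subnDA natrB// natrD.
have uu' : u%:R + u%:R <= H%:R :> R by rewrite -natrD ler_nat.
have u0 : 0 <= u%:R :> R by [].
have Y1 : Yv <= 1.
  have : p * (1 - dl) * (1 - dl) <= 1 * 1 * 1.
    rewrite ler_pM ?mulr_ge0 ?subr_ge0 ?(ltW p_gt0)// ?gerBl ?(ltW dl0)//.
    by rewrite ler_pM ?subr_ge0 ?(ltW p_gt0)// ?p_le1 ?gerBl ?(ltW dl0).
  by rewrite !mul1r => h; rewrite /Yv lerBlDr (le_trans h)// lerDl ltW.
have Yp : p - 3 * dl <= Yv.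
  have h1 : p * dl <= 1 * dl by rewrite ler_wpM2r ?p_le1// ltW.
  have h2 : 0 <= p * dl * dl by rewrite mulr_ge0 ?mulr_ge0// ltW.
  have -> : Yv = p - 2 * (p * dl) + p * dl * dl - dl by rewrite /Yv; ring.
  move: h1 h2; move: (p * dl * dl) (p * dl) p (dl) => w z x y; lra.
apply/negP; rewrite -ltNge.
have hd : 0 < H%:R * dl by rewrite mulr_gt0.
apply: (@lt_le_trans _ _ (H%:R * (p - 7 * dl))).
  rewrite ltr_pM2l//; move: dle dl0; move: (dl) => y; lra.
move: u2 uu' u0 Y1 Yp; move: (u%:R : R) (H%:R : R) H0' => x y y0 u2 uu' u0 Y1 Yp.
apply: (@le_trans _ _ (y * Yv - (x + x))).
  have : y * (p - 3 * dl) <= y * Yv by rewrite ler_wpM2l// ltW.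
  move: u2; move: (dl) (y * Yv) => z w; nra.
rewrite mulrBl lerD2l lerN2 -[leRHS]mulr1 ler_wpM2l// addr_ge0//.
Qed.

(** The fractional parts of the differences are directed to 1/2 for the value
n^c itself and near 0 for the others. Then the fractional parts in the Newton
formula for (n + j)^c add up to a number close to 1/2, and there is no carry. *)
Lemma ipow_newton (L : nat) : exists eta : R, [/\ 0 < eta, eta <= 1 / 8 & exists n1, forall t n j,
  t 0%N = 1 / 2 -> (forall i, (0 < i)%N -> t i = 2 * eta) -> (n1 <= n)%N -> (j <= L)%N ->
  ~~ off_target (powdif c) eta (iota 0 d.+1) t n ->
  (ipow c (n + j))%:R = \sum_(i < d.+1) 'C(j, i)%:R * (Num.floor (powdif c i n))%:~R :> R].
Proof.
have /andP[_ cd] := truncn_lt.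
pose K : R := (d.+1 * 2 ^ L)%:R.
have K1 : 1 <= K by rewrite (ler_nat _ 1) muln_gt0 expn_gt0.
have K0 : 0 < K by rewrite (lt_le_trans _ K1).
(* K bounds the sum of the binomial coefficients, so the fractional parts move
   by at most 3 K eta = 1/4 *)
pose eta : R := 1 / (12 * K).
have eta0 : 0 < eta by rewrite divr_gt0// mulr_gt0.
have etaK : 12 * (K * eta) = 1 by rewrite /eta; move: (K) K0 => k k0; field; rewrite gt_eqF.
have eta8 : eta <= 1 / 8.
  have : 1 * eta <= K * eta by rewrite ler_wpM2r// ltW.
  by move: etaK; move: (K * eta) (eta) => x y; lra.
exists eta; split => //.
have e8 : 0 < 1 / 8 :> R by rewrite divr_gt0.
have [n1 hn1] := powR_newton L cd e8.
exists n1 => t n j t0 ti n1n jL nb.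
pose k i : R := (Num.floor (powdif c i n))%:~R.
have close i : (i <= d)%N -> `|powdif c i n - t i - k i| < eta.
  move=> id; apply: floor_close => //.
  - case: i id => [|i] _; first by rewrite t0; move: eta8; lra.
    by rewrite ti//; move: eta0; lra.
  - case: i id => [|i] _; first by rewrite t0; move: eta8; lra.
    by rewrite ti//; move: eta8; lra.
  - move=> fi; move/asboolPn: nb; apply; exists i => //.
    by rewrite mem_iota add0n ltnS.
pose z : int := \sum_(i < d.+1) 'C(j, i)%:Z * Num.floor (powdif c i n).
have zE : z%:~R = \sum_(i < d.+1) 'C(j, i)%:R * k i :> R.
  by rewrite /z rmorph_sum; apply: eq_bigr => i _; rewrite rmorphM.
have x0 : 0 <= (n + j)%:R `^ c by exact: powR_ge0.
suff h : `|(n + j)%:R `^ c - z%:~R - 1 / 2| < 1 / 2.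
  rewrite /ipow -floor_truncn// -zE; congr (_%:~R).
  apply: floor_def; rewrite intrD /=.
  move: h; rewrite ltr_norml => /andP[h1 h2]; apply/andP; split; move: h1 h2; lra.
pose t' i : R := if i == 0%N then 0 else 2 * eta.
have tt' i : t i = t' i + (if i == 0%N then 1 / 2 else 0).
  by rewrite /t'; case: eqP => [->|/eqP i0]; rewrite ?t0 ?add0r// ti ?addr0// lt0n.
have -> : (n + j)%:R `^ c - z%:~R - 1 / 2 =
   ((n + j)%:R `^ c - \sum_(i < d.+1) 'C(j, i)%:R * powdif c i n) +
   \sum_(i < d.+1) 'C(j, i)%:R * ((powdif c i n - t i - k i) + t' i).
  have -> : \sum_(i < d.+1) 'C(j, i)%:R * ((powdif c i n - t i - k i) + t' i) =
    \sum_(i < d.+1) 'C(j, i)%:R * powdif c i n - z%:~R - \sum_(i < d.+1) 'C(j, i)%:R * (if i == 0%N :> nat then 1 / 2 else 0).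
    rewrite zE -!sumrB; apply: eq_bigr => i _; rewrite tt'; ring.
  have -> : \sum_(i < d.+1) 'C(j, i)%:R * (if i == 0%N :> nat then 1 / 2 else 0) = 1 / 2 :> R.
    by rewrite big_ord_recl bin0 /= big1 ?addr0 ?mul1r// => i _; rewrite /= mulr0.
  by rewrite !addrA subrK.
apply: (@le_lt_trans _ _ (1 / 8 + \sum_(i < d.+1) (2 ^ L)%:R * (3 * eta))).
  rewrite (le_trans (ler_normD _ _))// lerD//; first exact: hn1.
  rewrite (le_trans (ler_norm_sum _ _ _))//; apply: ler_sum => i _.
  rewrite normrM normr_nat ler_pM//.
    by rewrite ler_nat (leq_trans (bin_le_exp2 _ _))// leq_exp2l.
  rewrite (le_trans (ler_normD _ _))// (_ : 3 * eta = eta + 2 * eta); last by ring.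
  rewrite lerD//; first by rewrite ltW// close// -ltnS.
  have e20 : 0 <= 2 * eta by rewrite mulr_ge0// ltW.
  by rewrite /t'; case: eqP => _; rewrite ?normr0// ger0_norm.
rewrite sumr_const card_ord -[X in _ + X]mulr_natl.
have -> : d.+1%:R * ((2 ^ L)%:R * (3 * eta)) = 3 * (K * eta).
  by rewrite /K natrM; ring.
move: etaK; move: (K * eta) => x; lra.
Qed.

(** By [ipow_newton] the distances [(n + j)^c], j <= L, are integral combinations
of the integral parts of the differences, provided that n is on target and
large. So [recurrence] applies to all of them at once, and its conclusion
provides a single n for which all L + 1 correlations are positive. *)
Lemma Delta1_thick : thick (Delta1 c S).
Proof.
move=> L _; pose J := L.+1.
have [eta [eta0 eta8 [n1 hnewton]]] := ipow_newton L.
pose kap := (p * (1 - 1 / 2)) ^+ J.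
have hf0 : 0 < 1 - 1 / 2 :> R by lra.
have kap0 : 0 < kap by rewrite exprn_gt0// mulr_gt0.
have kap1 : kap <= 1.
  rewrite expr_le1// ?mulr_ge0 ?(ltW p_gt0) ?(ltW hf0)//.
  by have := p_le1; have := p_gt0; move: (p) => x; lra.
have J0 : 0 < J%:R :> R by rewrite ltr0n.
(* the main term is at least 7 kap / 8, the loss J (3 e) is kap / 8 *)
pose e := kap / (24 * J%:R).
have e0 : 0 < e by rewrite divr_gt0// mulr_gt0.
have eJ : 24 * (J%:R * e) = kap by rewrite /e; field; rewrite gt_eqF.
have e24 : 24 * e <= 1.
  rewrite (le_trans _ kap1)// -eJ ler_pM2l// ler_peMl ?(ltW e0)// ler1n //.
pose s := iota 0 d.+1.
have sd : all (fun i => i <= d)%N s by apply/allP => i; rewrite mem_iota add0n ltnS.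
have eta2 : eta <= 1 / 2 by move: eta8; lra.
have [H /andP[H0 _] hH] := @weight_core R (powdif c) d weyl_family_powdif s eta e 0
   sd (iota_uniq _ _) eta0 eta2 e0.
have X0 : 0 <= H%:R ^+ size s :> R by rewrite exprn_ge0.
(* n = 0 and the n too small for the Newton formula are discarded *)
pose n2 := maxn 1 n1.
pose Nn := (Num.truncn (H%:R ^+ size s * n2%:R / e)).+1.
have [Q wQ [hq hcos]] := hH Nn.
pose t i : R := if i == 0%N then 1 / 2 else 2 * eta.
have tok j : j \in s -> eta <= t j <= 1 - eta.
  by move=> _; rewrite /t; case: eqP => _; apply/andP; split; move: eta8 eta0; lra.
pose w := weight (powdif c) H s t.
have w0 n : 0 <= w n by exact: weight_ge0.
pose ok n := ~~ off_target (powdif c) eta s t n && (n2 <= n)%N.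
pose v n := w n * (ok n)%:R.
have v0 n : 0 <= v n by rewrite mulr_ge0.
have loss q : q \in Q -> \sum_(n < q.2) w n * (1 - (ok n)%:R) <= 2 * e * q.2%:R.
  move=> qQ; have [q0 _ hbad] := hq q t qQ.
  apply: (@le_trans _ _ (\sum_(n < q.2) (w n * (off_target (powdif c) eta s t n)%:R +
      H%:R ^+ size s * (n < n2)%N%:R))).
    apply: ler_sum => n _; rewrite /ok ltnNge.
    have wH := weight_le (powdif c) s t n H0; have wn := w0 n.
    case: (off_target _ _ _ _ _); case: (n2 <= n)%N => /=;
      rewrite ?subr0 ?subrr ?mulr0 ?mulr1 ?addr0 ?add0r// lerDl//.
  rewrite big_split -mulr_sumr sum_ltn_ind.
  have [_] := wQ.1 q qQ => qN.
  have h : H%:R ^+ size s * n2%:R <= e * q.2%:R.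
    by rewrite [e * _]mulrC -ler_pdivrMr// ltW// (lt_le_trans (truncnS_gt _))// ler_nat.
  rewrite (_ : 2 * e * q.2%:R = e * q.2%:R + e * q.2%:R); last by ring.
  rewrite lerD// (le_trans _ h)// ler_wpM2l// ler_nat; exact: geq_minr.
have mean1 : 1 - 3 * e <= wavg Q v (fun=> 1).
  have one : \sum_(q <- Q) q.1 * 1 = 1 by under eq_bigr do rewrite mulr1; exact: wQ.2.
  rewrite lerBlDr -[leLHS]one /wavg; apply: (wsum_le wQ) => q qQ.
  have [q0 hm _] := hq q t qQ; have q0' : 0 < q.2%:R :> R by rewrite ltr0n.
  rewrite -lerBlDr ler_pdivlMr//.
  have -> : \sum_(n < q.2) v n * 1 = \sum_(n < q.2) w n - \sum_(n < q.2) w n * (1 - (ok n)%:R).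
    by rewrite -sumrB; apply: eq_bigr => n _; rewrite /v; ring.
  move: hm (loss q qQ); rewrite ler_norml => /andP[+ _]; rewrite -/w.
  move: (\sum_(n < q.2) w n) (\sum_(n < q.2) w n * _) => x y; lra.
have hc (b : nat -> R) : - (3 * e) <= wavg Q v (fun n =>
    cos (tau * \sum_(j < J) b j * (ipow c (n + j))%:R)).
  (* the frequencies with respect to the integral parts of the differences *)
  pose b' i := if (i <= d)%N then \sum_(j < J) b j * 'C(j, i)%:R else 0.
  have b's j : j \notin s -> b' j = 0.
    by rewrite mem_iota leq0n andTb add0n ltnS /b' => /negbTE ->.
  have := hcos t b' tok b's => hb.
  suff : \sum_(q <- Q) q.1 * ((\sum_(n < q.2) w n * cos (floor_phase (powdif c) d b' n)) / q.2%:R) <=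
     wavg Q v (fun n => cos (tau * \sum_(j < J) b j * (ipow c (n + j))%:R)) + 2 * e.
    by move: hb; rewrite -/w; move: (\sum_(q <- Q) _) (wavg _ _ _) => x y; lra.
  rewrite /wavg; apply: (wsum_le wQ) => q qQ.
  have [q0 _ _] := hq q t qQ; have q0' : 0 < q.2%:R :> R by rewrite ltr0n.
  rewrite ler_pdivrMr// mulrDl divfK ?gt_eqF//.
  apply: (le_trans _ (lerD (lexx _) (loss q qQ))); rewrite -big_split.
  apply: ler_sum => n _ /=; rewrite /v.
  have [okn|nok] := boolP (ok n); last first.
    by rewrite mulr0 mul0r add0r subr0 ler_wpM2l// cos_le1.
  rewrite subrr mulr0 addr0 mulr1 le_eqVlt; apply/orP; left; apply/eqP.
  congr (_ * cos (_ * _)).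
  have /andP[nb] := okn; rewrite geq_max => /andP[_ n1n].
  transitivity (\sum_(i < d.+1) \sum_(j < J) b j * 'C(j, i)%:R * (Num.floor (powdif c i n))%:~R).
    by apply: eq_bigr => i _; rewrite /b' -ltnS ltn_ord mulr_suml.
  rewrite exchange_big /=; apply: eq_bigr => j _.
  rewrite (hnewton t n j)//; last by rewrite -ltnS.
    by rewrite mulr_sumr; apply: eq_bigr => i _; rewrite mulrA.
  by move=> i; rewrite /t; case: i.
have lam0 : 0 <= wavg Q v (fun=> 1).
  by rewrite (le_trans _ mean1)//; move: e24 e0; lra.
have e30 : 0 <= 3 * e by rewrite mulr_ge0// ltW.
have half0 : 0 < 1 / 2 :> R by rewrite divr_gt0.
have half1 : 1 / 2 <= 1 :> R by rewrite ler_pdivrMr// mul1r ler1n.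
have [f [f01 fret hf]] :=
  recurrence (m_ := fun j n => ipow c (n + j)) p_gt0 hS half0 half1 e30 hc lam0.
have fpos : 0 < wavg Q v f.
  apply: lt_le_trans hf; rewrite -/kap.
  have : kap * (1 - 3 * e) <= kap * wavg Q v (fun=> 1) by rewrite ler_wpM2l// ltW.
  have : kap * (3 * e) <= kap * (1 / 8) by rewrite ler_wpM2l ?(ltW kap0)//; move: e24; lra.
  rewrite (_ : J%:R * (3 * e) = 3 * (J%:R * e)); last by ring.
  move: eJ kap0; move: (J%:R * e) (kap * wavg _ _ _) => x y; lra.
have [n [okn fn]] : exists n, ok n /\ 0 < f n.
  apply: contrapT => hno; move: fpos; rewrite /wavg big1 ?ltxx// => q _.
  rewrite big1 ?mul0r ?mulr0// => n _; rewrite /v.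
  case: (boolP (ok n)) => [okn|_]; last by rewrite mulr0 mul0r.
  suff -> : f n = 0 by rewrite mulr0.
  apply/eqP; rewrite eq_le; have /andP[-> _] := f01 n; rewrite andbT leNgt.
  by apply/negP => fn; apply: hno; exists n.
have /andP[_] := okn; rewrite geq_max => /andP[n0 _].
exists n => // i iL; have [x [Sx Sxm]] := fret n i fn iL.
by apply: Delta1P Sxm => //; rewrite addn_gt0 n0.
Qed.

End Returns.

(** * The theorem *)

Theorem theorem1p2 (R : realType) (c : R) (k : nat) (S_ : 'I_k -> set nat)
    (c_gt0 : 0 < c) (c_nat : c \isn't a Num.nat) (k_gt0 : (0 < k)%N)
    (S_pos : forall i, S_ i `<=` posnats)
    (S_dens : forall i, 0 < upper_density R (S_ i)) :
  let D := \bigcap_(i in [set: 'I_k]) Delta2 c (S_ i) in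
  (exists S : set nat,
     [/\ S `<=` posnats,
         exists2 x : R, has_density S x &
           \prod_(i < k) upper_density R (S_ i) <= x,
         Delta1 c S `<=` D &
         \prod_(i < k) upper_density R (S_ i)
           <= upper_density R (Delta1 c S)]) /\
  thick D.
Proof.
set p := \prod_(i < k) upper_density R (S_ i).
have p0 : 0 < p by apply: prodr_gt0.
move=> D.
pose A := [set m | forall i, 0 < upper_density R (S_ i `&` shift_down (S_ i) m)].
have wp : window_density A p.
  move=> L; have [E [sE hE aE]] :=
    dense_common_copy (enum 'I_k) (iota 1 L) S_pos S_dens.
  exists E => //; split.
    by move=> u v uE vE uv i; apply: (aE i _ u v) => //; rewrite mem_enum.
  by move: hE; rewrite size_iota big_enum.
have [S [x [Spos aS dS px hS]]] := density_attained (ltW p0) wp.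
have x0 : 0 < x := lt_le_trans p0 px.
have sub : Delta1 c S `<=` D.
  move=> n [n0 [j [Sj [_ Sjm]]]] i _; split => //.
  have := aS _ _ Sj Sjm (leq_addr _ _); rewrite addKn; exact.
split.
  exists S; split => //; first by exists x.
  by rewrite (le_trans px)//; exact: (Delta1_density c_gt0 c_nat Spos x0 hS).
move=> n n0; have [a a0 ha] := Delta1_thick c_gt0 c_nat Spos x0 hS n0.
by exists a => // i ni; apply: sub; exact: ha.
Qed.
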